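(* Let $\phi:\mathbb Z\to\mathbb C$ be a finitely supported complex-valued function with $\sum_{x\in\mathbb Z}\phi(x)=1$. Assume that $\hat\phi(\theta)=\sum_{x}\phi(x)e^{ix\theta}$ satisfies $|\hat\phi(\theta)|<1$ for all $\theta\in(-\pi,\pi]$ with $\theta\neq0$. Assume further that there exist an even integer $\nu$ and a complex number $\gamma$ with $\operatorname{Re}(\gamma)>0$ such that $$\hat\phi(\theta)=e^{-\gamma\theta^\nu(1+o(1))}\qquad\text{as }\theta\to0.$$ Then there are constants $c,C\in(0,\infty)$ such that, for all $x\in\mathbb Z$ and $n\in\mathbb N^*$, $$|\phi^{(n)}(x)|\le\frac{C}{n^{1/\nu}}\exp\left(-c\left(\frac{|x|}{n^{1/\nu}}\right)^{\nu/(\nu-1)}\right).$$ Further, there are constants $c_1,c_2>0$ such that, for all $x\in\mathbb Z$, $n\in\mathbb N$ with $|x|\le c_1n^{1/\nu}$, we have $$\operatorname{Re}(\phi^{(n)}(x))\ge c_2n^{-1/\nu}$$ and (i) if $\operatorname{Im}(\gamma)\ne0$, then $|\operatorname{Im}(\phi^{(n)}(x))|\ge c_2n^{-1/\nu}$, with $\operatorname{Im}(\phi^{(n)}(x))$ having the same sign as $\operatorname{Im}(\gamma)$; (ii) if $\operatorname{Im}(\gamma)=0$, then $|\operatorname{Im}(\phi^{(n)}(x))|=o(n^{-1/\nu})$.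
   Context: Convolution powers are defined by $\phi^{(1)}=\phi$ and $\phi^{(n)}(x)=\sum_{y\in\mathbb Z}\phi^{(n-1)}(y)\phi(x-y)$. $\mathbb N^*$ denotes the positive integers and $\mathbb N$ the natural numbers (the bounds involving $n^{-1/\nu}$ are meaningful for $n\ge1$).
   Formalization: The lower bounds on Re and Im are claimed only for n at least some N depending on φ (false for small n in general), and in (i) the imaginary part of φ^(n)(x) has the sign opposite to Im(γ), the printed sign being false. *)

(* Defs.v *)
From mathcomp Require Export all_boot all_order all_algebra.
From mathcomp Require Export all_classical all_reals all_analysis.
From mathcomp Require Export complex.

Set Implicit Arguments.
Unset Strict Implicit.
Unset Printing Implicit Defensive.

Export Order.TTheory GRing.Theory Num.Theory.
Export numFieldNormedType.Exports.

Local Open Scope classical_set_scope.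
Local Open Scope ring_scope.
Local Open Scope complex_scope.

Definition cexp (R : realType) (z : R[i]) : R[i] :=
  (expR (complex.Re z))%:C * (cos (complex.Im z) +i* sin (complex.Im z)).

(* [\sum_(x \in A) F x] is the sum over the finitely many x in A with
   F x != 0, and is 0 by convention when there are infinitely many. *)
Definition fourier (R : realType) (phi : int -> R[i]) (t : R) : R[i] :=
  \sum_(x \in [set: int]) (phi x * cexp ((x%:~R * t) *i)).

(* Only exponents n >= 1 are meant; the value at 0 is the usual convention. *)
Fixpoint convpow (R : realType) (phi : int -> R[i]) (n : nat) : int -> R[i] :=
  match n with
  | 0 => fun x => (x == 0)%:R
  | 1 => phi
  | m.+1 => fun x => \sum_(y \in [set: int]) (convpow phi m y * phi (x - y))
  end.

(* Main.v *)
Require Import Defs.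
From mathcomp Require Import ring lra zify.

Set Implicit Arguments.
Unset Strict Implicit.
Unset Printing Implicit Defensive.

Local Open Scope classical_set_scope.
Local Open Scope ring_scope.
Local Open Scope complex_scope.

Local Notation Re := complex.Re.
Local Notation Im := complex.Im.
Local Notation normc := ComplexField.Normc.normc.

(** The idea. Let P be the symbol of phi, its Fourier transform extended to
    complex frequencies. Since phi has finite support, phi^(n) is a coefficient
    of the n-th power of a polynomial, and it is recovered from P^n by an average
    over the 2 K + 1 equidistant frequencies of ]- pi, pi[, where [-K, K]
    contains its support ([convpow_inversion]). The average may be taken on any
    line of the complex plane parallel to the real axis. With r the v-th root of
    n, the frequencies multiplied by r form a mesh of width h = O(1 / r), so every
    integral of the classical proof is replaced by a Riemann sum with an explicit
    error, and no integration theory is used.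

    The asymptotic of the symbol on the real line forces the even exponent v to be at
    least 2 ([exponent_ge2]) and determines the Taylor expansion of the entire function P
    up to order v, so that P z = 1 - gamma z^v + O(|z|^(v+1)) in the complex plane
    ([symbol_expansion]). Together with |P| < 1 on the rest of the period and the
    exponential growth of P in the imaginary direction this gives
      |P (t + i s)| <= exp (- c |t|^v + C |s|^v)    ([symbol_bound]).
    Inverting on the line of imaginary part s gives
      |phi^(n)(x)| <= B / r exp (x s + C n |s|^v),
    and the upper bound follows by taking s of order (|x| / n)^(1 / (v - 1)), with
    the sign opposite to that of x ([convpow_upper_bound]).

    On the real line, P^n can be replaced by exp (- gamma n t^v) with an error
    O(1 / r^2) in the average ([convpow_sub_kernel]), and x by 0 at the price of
    O(|x| / r^2) ([kernel_sum_recenter]). It remains to find the argument of the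
    integral of exp (- gamma u^v). Writing gamma = rho exp (i tau), one rotates
    gamma to rho: the derivative in t of exp (i t / v) times the integral of
    exp (- rho exp (i t) u^v) is the integral of a total derivative and vanishes
    ([rotated_stationary] for Riemann sums). Hence r phi^(n)(x) is close to a
    positive number times exp (- i tau / v) ([local_limit]). As |tau| < pi / 2,
    its real part is positive and its imaginary part has the sign opposite to
    that of Im gamma. When gamma is real the approximating sum is itself real by
    symmetry ([kernel_sum_real]), whence the negligible imaginary part. *)

(** * Complex modulus and exponential *)

Section ComplexNorm.
Variable R : realType.
Implicit Types z w : R[i].

Lemma normc_norm z : `|z| = (normc z)%:C.
Proof. by []. Qed.

Lemma normc_ge0 z : 0 <= normc z.
Proof. by case: z => a b; exact: sqrtr_ge0. Qed.

Lemma normc0 : normc (0 : R[i]) = 0.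
Proof. exact: ComplexField.Normc.normc0. Qed.

Lemma normc1 : normc (1 : R[i]) = 1.
Proof. exact: ComplexField.Normc.normc1. Qed.

Lemma normcD z w : normc (z + w) <= normc z + normc w.
Proof. exact: le_normcD. Qed.

Lemma normcM z w : normc (z * w) = normc z * normc w.
Proof. exact: ComplexField.Normc.normcM. Qed.

Lemma normcN z : normc (- z) = normc z.
Proof. exact: complex.normcN. Qed.

Lemma normcBC z w : normc (z - w) = normc (w - z).
Proof. by rewrite -normcN opprB. Qed.

Lemma normcB z w : normc (z - w) <= normc z + normc w.
Proof. by rewrite -(normcN w) normcD. Qed.

Lemma normcX z n : normc (z ^+ n) = normc z ^+ n.
Proof.
by elim: n => [|n ih]; rewrite ?expr0 ?normc1// !exprS normcM ih.
Qed.

Lemma normc_real (a : R) : normc a%:C = `|a|.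
Proof. by rewrite /normc /= expr0n /= addr0 sqrtr_sqr. Qed.

Lemma normc_i (a : R) : normc (a *i) = `|a|.
Proof. by rewrite /normc /= expr0n /= add0r sqrtr_sqr. Qed.

Lemma normc_sum (I : Type) (s : seq I) (P : pred I) (F : I -> R[i]) :
  normc (\sum_(i <- s | P i) F i) <= \sum_(i <- s | P i) normc (F i).
Proof.
elim/big_ind2: _ => [||//]; first by rewrite normc0.
by move=> x1 x2 y1 y2 h1 h2; apply: le_trans (normcD _ _) _; exact: lerD.
Qed.

Lemma Re_le_normc z : `|Re z| <= normc z.
Proof.
by case: z => a b /=; rewrite -sqrtr_sqr ler_wsqrtr// lerDl sqr_ge0.
Qed.

Lemma Im_le_normc z : `|Im z| <= normc z.
Proof.
by case: z => a b /=; rewrite -sqrtr_sqr ler_wsqrtr// lerDr sqr_ge0.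
Qed.

Lemma normc_le_ReIm z : normc z <= `|Re z| + `|Im z|.
Proof.
case: z => a b /=; rewrite -[leRHS]ger0_norm ?addr_ge0//.
rewrite -[leRHS]sqrtr_sqr ler_wsqrtr// sqrrD !real_normK ?num_real//.
by rewrite addrAC lerDl mulrn_wge0// mulr_ge0.
Qed.

Lemma ReD z w : Re (z + w) = Re z + Re w.
Proof. by case: z; case: w. Qed.
Lemma ImD z w : Im (z + w) = Im z + Im w.
Proof. by case: z; case: w. Qed.
Lemma ReN z : Re (- z) = - Re z.
Proof. by case: z. Qed.
Lemma ImN z : Im (- z) = - Im z.
Proof. by case: z. Qed.
Lemma ReM z w : Re (z * w) = Re z * Re w - Im z * Im w.
Proof. by case: z; case: w. Qed.
Lemma ImM z w : Im (z * w) = Re z * Im w + Im z * Re w.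
Proof. by case: z; case: w. Qed.
Lemma Im_sum (I : Type) (s : seq I) (P : pred I) (F : I -> R[i]) :
  Im (\sum_(i <- s | P i) F i) = \sum_(i <- s | P i) Im (F i).
Proof. by apply: (big_morph (@complex.Im R)) => //; exact: ImD. Qed.

Lemma complexP z w : Re z = Re w -> Im z = Im w -> z = w.
Proof. by case: z; case: w => a b c d /= -> ->. Qed.

End ComplexNorm.

Section ComplexExponential.
Variable R : realType.
Implicit Types z w : R[i].

Lemma cexpE z : cexp z = (expR (Re z) * cos (Im z)) +i* (expR (Re z) * sin (Im z)).
Proof. by apply: complexP; rewrite /cexp ?ReM ?ImM /=; ring. Qed.

Lemma cexp0 : cexp (0 : R[i]) = 1.
Proof. by rewrite cexpE /= expR0 cos0 sin0 mulr1 mulr0. Qed.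

Lemma cexpD z w : cexp (z + w) = cexp z * cexp w.
Proof.
by rewrite !cexpE; apply: complexP;
  rewrite ?ReM ?ImM /= ReD ImD expRD ?cosD ?sinD; ring.
Qed.

Lemma normc_cexp z : normc (cexp z) = expR (Re z).
Proof.
rewrite /cexp normcM normc_real /= cos2Dsin2 sqrtr1 mulr1.
by rewrite gtr0_norm// expR_gt0.
Qed.

Lemma cexp_neq0 z : cexp z != 0.
Proof.
apply/eqP => h; have := expR_gt0 (Re z).
by rewrite -normc_cexp h normc0 ltxx.
Qed.

Lemma cexpN z : cexp (- z) = (cexp z)^-1.
Proof.
apply: (mulfI (cexp_neq0 z)).
by rewrite -cexpD subrr cexp0 mulfV// cexp_neq0.
Qed.

Lemma cexpX z n : cexp z ^+ n = cexp (n%:R * z).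
Proof.
elim: n => [|n ih]; first by rewrite expr0 mul0r cexp0.
by rewrite exprS ih -cexpD -natr1 mulrDl mul1r addrC.
Qed.

Lemma cexp_real (a : R) : cexp a%:C = (expR a)%:C.
Proof. by rewrite cexpE /= cos0 sin0 mulr1 mulr0. Qed.

(** Curves in the complex plane are differentiated componentwise, because the
    exponential is defined by its real and imaginary parts. *)
Definition cderive (f : R -> R[i]) (t : R) (d : R[i]) :=
  is_derive t (1 : R) (fun u => Re (f u)) (Re d) /\
  is_derive t (1 : R) (fun u => Im (f u)) (Im d).

Lemma cderive_eq f t d d' : cderive f t d -> d = d' -> cderive f t d'.
Proof. by move=> h <-. Qed.

Lemma cderive_cst c t : cderive (fun=> c) t 0.
Proof. by split; exact: is_derive_cst. Qed.

Lemma cderive_id t : cderive (fun u => u%:C) t 1.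
Proof. by split; [exact: is_derive_id | exact: is_derive_cst]. Qed.

Lemma cderiveD f g t df dg : cderive f t df -> cderive g t dg ->
  cderive (fun u => f u + g u) t (df + dg).
Proof.
move=> [f1 f2] [g1 g2]; split.
  by under eq_fun do rewrite ReD; rewrite ReD; exact: is_deriveD.
by under eq_fun do rewrite ImD; rewrite ImD; exact: is_deriveD.
Qed.

Lemma cderiveM f g t df dg : cderive f t df -> cderive g t dg ->
  cderive (fun u => f u * g u) t (df * g t + f t * dg).
Proof.
move=> [f1 f2] [g1 g2]; split.
  under eq_fun do rewrite ReM.
  have h := is_deriveB (is_deriveM f1 g1) (is_deriveM f2 g2).
  by apply: is_derive_eq; rewrite /GRing.scale /= ReD !ReM; ring.
under eq_fun do rewrite ImM.
have h := is_deriveD (is_deriveM f1 g2) (is_deriveM f2 g1).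
by apply: is_derive_eq; rewrite /GRing.scale /= ImD !ImM; ring.
Qed.

Lemma cderiveZ c f t df : cderive f t df -> cderive (fun u => c * f u) t (c * df).
Proof.
move=> h; apply: cderive_eq (cderiveM (cderive_cst c t) h) _.
by rewrite mul0r add0r.
Qed.

Lemma cderiveN f t df : cderive f t df -> cderive (fun u => - f u) t (- df).
Proof.
move=> h; under [X in cderive X]eq_fun do rewrite -mulN1r.
by rewrite -(mulN1r df); exact: cderiveZ.
Qed.

Lemma cderiveB f g t df dg : cderive f t df -> cderive g t dg ->
  cderive (fun u => f u - g u) t (df - dg).
Proof. by move=> hf hg; apply: cderiveD => //; exact: cderiveN. Qed.

Lemma cderive_sum n (f : 'I_n -> R -> R[i]) t (df : 'I_n -> R[i]) :
  (forall i, cderive (f i) t (df i)) ->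
  cderive (fun u => \sum_(i < n) f i u) t (\sum_(i < n) df i).
Proof.
elim: n f df => [|n ih] f df h.
  under [X in cderive X]eq_fun do rewrite big_ord0.
  by rewrite big_ord0; exact: cderive_cst.
under [X in cderive X]eq_fun do rewrite big_ord_recl.
by rewrite big_ord_recl; apply: cderiveD => //; exact: ih.
Qed.

Lemma cderiveX f t df n : cderive f t df ->
  cderive (fun u => f u ^+ n) t (n%:R * f t ^+ n.-1 * df).
Proof.
move=> h; elim: n => [|n ih].
  by under [X in cderive X]eq_fun do rewrite expr0; rewrite !mul0r; exact: cderive_cst.
under [X in cderive X]eq_fun do rewrite exprS.
apply: cderive_eq (cderiveM h ih) _.
case: n {ih} => [|n] /=; first by rewrite !expr0; ring.
by rewrite exprS -!natr1; ring.
Qed.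

Lemma cderive_cexp f t df : cderive f t df ->
  cderive (fun u => cexp (f u)) t (df * cexp (f t)).
Proof.
move=> [f1 f2]; rewrite cexpE.
under [X in cderive X]eq_fun do rewrite cexpE.
have e1 := is_derive1_comp (is_derive_expR (Re (f t))) f1.
have c1 := is_derive1_comp (is_derive_cos (Im (f t))) f2.
have s1 := is_derive1_comp (is_derive_sin (Im (f t))) f2.
split => /=.
  have h := is_deriveM e1 c1.
  by apply: is_derive_eq; rewrite /GRing.scale /= ReM /=; ring.
have h := is_deriveM e1 s1.
by apply: is_derive_eq; rewrite /GRing.scale /= ImM /=; ring.
Qed.

(** The factor 2 pays for applying the real mean value theorem to each
    component separately. *)
Lemma cderive_le (f df : R -> R[i]) (a b M : R) : a <= b ->
  (forall t, cderive f t (df t)) ->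
  (forall t, t \in `[a, b] -> normc (df t) <= M) ->
  normc (f b - f a) <= 2 * M * (b - a).
Proof.
move=> ab fd dM.
have key (g dg : R -> R) : (forall t, is_derive t (1 : R) g (dg t)) ->
    (forall t, t \in `[a, b] -> `|dg t| <= M) -> `|g b - g a| <= M * (b - a).
  move=> gd gM; have [|c cab ->] := MVT_segment ab (fun x _ => gd x).
    apply: continuous_subspaceT => x; apply: differentiable_continuous.
    by apply/derivable1_diffP; exact: ex_derive.
  by rewrite normrM (ger0_norm (_ : 0 <= b - a)) ?subr_ge0// ler_wpM2r ?subr_ge0// gM.
apply: le_trans (normc_le_ReIm _) _.
rewrite ReD ReN ImD ImN.
have h1 := key _ _ (fun t => (fd t).1) (fun t h => le_trans (Re_le_normc _) (dM t h)).
have h2 := key _ _ (fun t => (fd t).2) (fun t h => le_trans (Im_le_normc _) (dM t h)).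
by apply: le_trans (lerD h1 h2) _; lra.
Qed.

(** Remainder of the exponential series, integrated one order at a time along
    the segment from 0 to w; each order costs the factor 2 of the mean value
    inequality. *)
Lemma cexp_taylor k w :
  normc (cexp w - \sum_(j < k) w ^+ j / (j`!)%:R) <=
  2 ^+ k * normc w ^+ k * expR (normc w).
Proof.
elim: k w => [|k ih] w.
  rewrite big_ord0 subr0 !mul1r normc_cexp ler_expR.
  exact: le_trans (ler_norm _) (Re_le_normc _).
pose E k z : R[i] := cexp z - \sum_(j < k) z ^+ j / (j`!)%:R.
have dE t : cderive (fun u => E k.+1 (u%:C * w)) t (w * E k (t%:C * w)).
  have dw : cderive (fun u => u%:C * w) t w.
    by apply: cderive_eq (cderiveM (cderive_id t) (cderive_cst w t)) _; ring.
  rewrite /E mulrBr; apply: cderiveB; first exact: cderive_cexp.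
  under [X in cderive X]eq_fun do rewrite big_ord_recl.
  rewrite mulr_sumr -[X in cderive _ _ X]add0r; apply: cderiveD.
    by under [X in cderive X]eq_fun do rewrite expr0; exact: cderive_cst.
  apply: cderive_sum => i; rewrite lift0.
  apply: cderive_eq (cderiveM (cderiveX _ dw) (cderive_cst _ _)) _.
  rewrite mulr0 addr0 /= factS natrM invfM.
  have : (i.+1%:R : R[i]) != 0 by rewrite pnatr_eq0.
  by move: (i.+1%:R : R[i]) (i`!%:R^-1 : R[i]) => a b a0; field.
have E0 : E k.+1 0 = 0.
  rewrite /E cexp0 big_ord_recl big1 ?addr0 ?expr0 ?divr1 ?subrr// => i _.
  by rewrite lift0 expr0n mul0r.
have := cderive_le ler01 dE.
move=> /(_ (normc w * (2 ^+ k * normc w ^+ k * expR (normc w)))).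
rewrite mul0r E0 mul1r subr0 subr0 mulr1 => h.
rewrite -/(E k.+1 w); apply: le_trans (h _) _; last first.
  by rewrite exprS exprS le_eqVlt; apply/orP; left; apply/eqP; ring.
move=> t; rewrite in_itv /= => /andP[t0 t1].
rewrite normcM ler_wpM2l ?normc_ge0//; apply: le_trans (ih _) _.
have tw : normc (t%:C * w) <= normc w.
  by rewrite normcM normc_real ger0_norm// ler_piMl// normc_ge0.
apply: ler_pM; rewrite ?mulr_ge0 ?exprn_ge0 ?expR_ge0 ?normc_ge0//.
  by rewrite ler_wpM2l ?exprn_ge0// lerXn2r ?nnegrE ?normc_ge0.
by rewrite ler_expR.
Qed.

End ComplexExponential.

(** * Fourier inversion by finite sums *)

Section Inversion.
Variable R : realType.
Implicit Types (phi : int -> R[i]) (z w : R[i]).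

Lemma fsum_interval (F : int -> R[i]) (A : int) (N : nat) :
  (forall x, F x != 0 -> A <= x < A + N%:Z) ->
  \sum_(x \in [set: int]) F x = \sum_(j < N) F (A + j%:Z).
Proof.
move=> supp; rewrite (fsbigE [seq A + j%:Z | j <- iota 0 N]) //.
- rewrite (eq_bigl xpredT); last by move=> x; exact: in_setT.
  by rewrite big_map -[N in iota 0 N]subn0 -/(index_iota 0 N) big_mkord.
- by rewrite map_inj_uniq ?iota_uniq// => i j /addrI [].
move=> x _; apply: contraNeq => /supp /andP[h1 h2].
apply/mapP; exists (absz (x - A)); first by rewrite mem_iota /=; lia.
by lia.
Qed.

Definition supported phi (L : nat) := forall x, phi x != 0 -> `|x| <= L%:Z.

Lemma finite_supported phi : finite_set [set x : int | phi x != 0] ->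
  exists2 L, (0 < L)%N & supported phi L.
Proof.
move=> /finite_seqP [s sE].
exists (\sum_(x <- s) absz x).+1 => // x px.
have xs : x \in s by have : [set x | phi x != 0] x by []; rewrite sE.
have : (absz x <= \sum_(x <- s) absz x)%N by rewrite (big_rem x)//= leq_addr.
by lia.
Qed.

Variables (phi : int -> R[i]) (L : nat).
Hypothesis suppL : supported phi L.

(** The Fourier transform at a complex frequency; the imaginary part of z tilts
    phi exponentially. *)
Definition symbol z :=
  \sum_(i < L.*2.+1) phi (i%:Z - L%:Z) * cexp ('i * (i%:Z - L%:Z)%:~R * z).

Lemma fourier_symbol (t : R) : fourier phi t = symbol t%:C.
Proof.
rewrite /fourier (@fsum_interval _ (- L%:Z) L.*2.+1).
  apply: eq_bigr => i _; rewrite addrC; congr (phi _ * cexp _).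
  rewrite -(rmorph_int (real_complex R)).
  by apply: complexP; rewrite !(ReM, ImM)/=; ring.
move=> x; case: (eqVneq (phi x) 0) => [-> |/suppL]; first by rewrite mul0r eqxx.
by lia.
Qed.

Lemma sum_symbol : \sum_(x \in [set: int]) phi x = symbol 0.
Proof.
rewrite (@fsum_interval _ (- L%:Z) L.*2.+1); last by move=> x /suppL; lia.
by apply: eq_bigr => i _; rewrite mulr0 cexp0 mulr1 addrC.
Qed.

Let p : {poly R[i]} := \poly_(i < L.*2.+1) phi (i%:Z - L%:Z).

Lemma symbol_horner z :
  symbol z = p.[cexp ('i * z)] * cexp (- (L%:R * ('i * z))).
Proof.
rewrite horner_poly mulr_suml; apply: eq_bigr => i _.
rewrite -[RHS]mulrA cexpX -cexpD; congr (_ * cexp _).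
by rewrite rmorphB /= -!pmulrn; ring.
Qed.

Let size_p_exp n : (size (p ^+ n) <= (n * L).*2.+1)%N.
Proof.
apply: leq_trans (size_poly_exp_leq _ _) _.
rewrite ltnS doubleMr mulnC leq_mul2l; apply/orP; right.
by have : (size p <= L.*2.+1)%N := size_poly _ _; lia.
Qed.

Let coef_p (i : nat) : p`_i = phi (i%:Z - L%:Z).
Proof.
rewrite coef_poly; case: ifP => // /negbT iL.
by apply/esym/eqP; apply: contraNT iL => /suppL; lia.
Qed.

(** Shifting by L turns convolution on the integers into multiplication of
    polynomials, so that inversion becomes extraction of a coefficient. *)
Let convpow_coef n : (0 < n)%N ->
  (forall i : nat, convpow phi n (i%:Z - (n * L)%:Z) = (p ^+ n)`_i) /\
  (forall x : int, x < - (n * L)%:Z -> convpow phi n x = 0).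
Proof.
case: n => // n _; elim: n => [|n [ih1 ih2]].
  rewrite mul1n expr1; split => [i|x xL]; first by rewrite coef_p.
  by apply/eqP; apply: contraTT xL => /suppL; lia.
have E x : convpow phi n.+2 x =
    \sum_(y \in [set: int]) (convpow phi n.+1 y * phi (x - y)) by [].
have supp x y : convpow phi n.+1 y * phi (x - y) != 0 ->
    - (n.+1 * L)%:Z <= y <= x + L%:Z.
  rewrite mulf_eq0 negb_or => /andP[cy /suppL xy].
  have : ~~ (y < - (n.+1 * L)%:Z) by apply: contra cy => /ih2 ->.
  by lia.
split => [i|x xL]; last first.
  rewrite E fsbig1// => y _; apply/eqP; apply/negPn/negP => /supp.
  by rewrite mulSn in xL *; lia.
rewrite E exprSr coefM (@fsum_interval _ (- (n.+1 * L)%:Z) i.+1).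
  apply: eq_bigr => j _; rewrite addrC ih1 coef_p; congr (_ * phi _).
  by have := ltn_ord j; rewrite (mulSn n.+1); lia.
by move=> y /supp; rewrite (mulSn n.+1); lia.
Qed.

Lemma convpow_supported n : (0 < n)%N -> supported (convpow phi n) (n * L).
Proof.
move=> n0 x; have [h1 h2] := convpow_coef n0.
case: (ltP x (- (n * L)%:Z)) => [/h2 ->|xge]; first by rewrite eqxx.
have -> : x = (absz (x + (n * L)%:Z))%:Z - (n * L)%:Z by lia.
rewrite h1; set i := absz _; move=> pn.
have : (i < size (p ^+ n))%N by apply: contraR pn; rewrite -leqNgt => /leq_sizeP ->.
by move: (size_p_exp n); lia.
Qed.

(** Centred at K, so that the frequencies are symmetric about 0 and stay within the
    period ]- pi, pi[ where the symbol is controlled. *)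
Definition freq (K k : nat) : R := 2 * pi * (k%:R - K%:R) / K.*2.+1%:R.

Lemma cexp_neq1 (y : R) : 0 < y < 2 * pi -> cexp (y *i) != 1.
Proof.
move=> /andP[y0 y1]; apply/eqP => /(congr1 (@complex.Re R)).
rewrite cexpE /= expR0 mul1r => cy.
have : 0 < sin (y / 2) by apply: sin_gt0_pi; lra.
have := cos2Dsin2 (y / 2); have := cosD (y / 2) (y / 2).
have -> : y / 2 + y / 2 = y by lra.
by rewrite cy; nra.
Qed.

Lemma cexp_period (l : int) : cexp ((2 * pi * l%:~R) *i) = 1 :> R[i].
Proof.
have key (j : nat) : cexp ((2 * pi * j%:R) *i) = 1 :> R[i].
  have -> : (2 * pi * j%:R) *i = j%:R * (2 * pi) *i :> R[i].
    by rewrite -(rmorph_nat (real_complex R));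
      apply: complexP; rewrite !(ReM, ImM)/=; ring.
  by rewrite -cexpX cexpE /= mulr_natl cos2pi sin2pi expR0 mul1r mulr0 expr1n.
case: l => j; first exact: key.
have -> : (2 * pi * (Negz j)%:~R) *i = - (2 * pi * j.+1%:R) *i :> R[i].
  by rewrite NegzE rmorphN /=; apply: complexP => /=; ring.
by rewrite cexpN key invr1.
Qed.

Lemma symbol_endpoints : symbol (- pi)%:C = symbol pi%:C.
Proof.
apply: eq_bigr => i _; congr (_ * _); set l := i%:Z - L%:Z.
have -> : 'i * l%:~R * pi%:C = 'i * l%:~R * (- pi)%:C + (2 * pi * l%:~R) *i :> R[i].
  rewrite -(rmorph_int (real_complex R)).
  by apply: complexP; rewrite !(ReD, ImD, ReM, ImM)/=; ring.
by rewrite cexpD cexp_period mulr1.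
Qed.

Lemma sum_roots_of_unity (m : nat) (l : int) : l != 0 -> `|l| < m%:Z ->
  \sum_(k < m) cexp ((2 * pi * l%:~R / m%:R) *i) ^+ k = 0 :> R[i].
Proof.
move=> l0 lm; set u := cexp _.
have m0 : 0 < m%:R :> R by rewrite ltr0n; lia.
have um : u ^+ m = 1.
  rewrite /u cexpX -(rmorph_nat (real_complex R)).
  have -> : m%:R%:C * (2 * pi * l%:~R / m%:R) *i = (2 * pi * l%:~R) *i :> R[i].
    by apply: complexP; rewrite !(ReM, ImM)/=; field; rewrite ?gt_eqF.
  exact: cexp_period.
have u1 : u != 1.
  have key (j : nat) : (0 < j < m)%N -> cexp ((2 * pi * j%:R / m%:R) *i) != 1 :> R[i].
    move=> /andP[j0 jm]; apply: cexp_neq1; have := pi_gt0 R => p0.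
    have j0' : 0 < j%:R :> R by rewrite ltr0n.
    have jm' : j%:R < m%:R :> R by rewrite ltr_nat.
    by rewrite divr_gt0 ?mulr_gt0//= ltr_pdivrMr// ltr_pM2l ?mulr_gt0.
  rewrite /u; case: l l0 lm {u um} => j l0 lm; first by apply: key; lia.
  have -> : (2 * pi * (Negz j)%:~R / m%:R) *i = - (2 * pi * j.+1%:R / m%:R) *i :> R[i].
    by rewrite NegzE rmorphN /=; apply: complexP => /=; ring.
  by rewrite cexpN invr_eq1 key//; lia.
apply/eqP; have := subrX1 u m; rewrite um subrr => /esym/eqP.
by rewrite mulf_eq0 subr_eq0 (negbTE u1).
Qed.

Let dft_coef (q : {poly R[i]}) (K j : nat) (w : R[i]) :
  (size q <= K.*2.+1)%N -> (j < K.*2.+1)%N ->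
  q`_j = K.*2.+1%:R^-1 * \sum_(k < K.*2.+1)
    q.[cexp ('i * ((freq K k)%:C + w))] *
    cexp (- (j%:R * ('i * ((freq K k)%:C + w)))).
Proof.
set m := K.*2.+1 => qm jm.
have m0 : m%:R != 0 :> R by rewrite pnatr_eq0.
under eq_bigr do rewrite (horner_coef_wide _ qm) mulr_suml.
rewrite exchange_big /= (bigD1 (Ordinal jm)) //= [X in _ + X]big1 ?addr0.
  under eq_bigr do rewrite -mulrA cexpX -cexpD subrr cexp0 mulr1.
  rewrite sumr_const card_ord -[q`_j *+ m]mulr_natl mulrA mulVf ?mul1r//.
  by rewrite pnatr_eq0.
move=> i ij.
have il : i%:Z - j%:Z != 0 :> int by move: ij; rewrite -val_eqE /=; lia.
transitivity (q`_i * cexp ('i * (i%:R - j%:R) *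
    ((- (2 * pi * K%:R / m%:R))%:C + w)) *
  \sum_(k < m) cexp ((2 * pi * (i%:Z - j%:Z)%:~R / m%:R) *i) ^+ k); last first.
  by rewrite sum_roots_of_unity ?mulr0//; have := ltn_ord i; lia.
rewrite mulr_sumr; apply: eq_bigr => k _.
rewrite -![q`_i * _ * _]mulrA !cexpX -!cexpD; congr (_ * cexp _).
rewrite /freq -/m rmorphB /= -!pmulrn -!(rmorph_nat (real_complex R)).
by apply: complexP; rewrite !(ReD, ImD, ReM, ImM, ReN, ImN)/=; field.
Qed.

(** Evaluating along a shifted line w costs nothing here: the shift is a change
    of variable in a polynomial and needs no contour deformation. *)
Lemma convpow_inversion n (x : int) w : (0 < n)%N -> `|x| <= (n * L)%:Z ->
  convpow phi n x = (n * L).*2.+1%:R^-1 * \sum_(k < (n * L).*2.+1)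
    symbol ((freq (n * L) k)%:C + w) ^+ n *
    cexp (- (x%:~R * ('i * ((freq (n * L) k)%:C + w)))).
Proof.
move=> n0 xn; have [h1 _] := convpow_coef n0.
pose j := absz (x + (n * L)%:Z).
have xE : x = j%:Z - (n * L)%:Z by rewrite /j; lia.
have jm : (j < (n * L).*2.+1)%N by rewrite /j; lia.
rewrite [in LHS]xE h1 (dft_coef w (size_p_exp n) jm); congr (_ * _).
apply: eq_bigr => k _; rewrite symbol_horner exprMn -horner_exp -mulrA.
rewrite cexpX -cexpD; congr (_ * cexp _).
by rewrite [in RHS]xE rmorphB /= -!pmulrn natrM; ring.
Qed.

End Inversion.

(** * Expansion of the symbol at the origin *)

Section Expansion.
Variable R : realType.
Implicit Types (z w gamma : R[i]) (t d e : R).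

Lemma near0P (P : R -> Prop) : (\forall t \near (0 : R)^', P t) <->
  exists2 d, 0 < d & forall t, t != 0 -> `|t| < d -> P t.
Proof.
split.
  move=> /nbhs_ballP[d d0 h]; exists d => // t t0 td; apply: h => //.
  by rewrite /ball /= sub0r normrN.
move=> [d d0 h]; apply/nbhs_ballP; exists d => // t.
by rewrite /ball /= sub0r normrN => td t0; exact: h.
Qed.

Lemma cvg0P (eps : R -> R[i]) :
  (eps t : R[i]^o) @[t --> (0 : R)^'] --> (0 : R[i]^o) ->
  forall e, 0 < e -> exists2 d, 0 < d & forall t, t != 0 -> `|t| < d -> normc (eps t) < e.
Proof.
move=> /cvgr0Pnorm_lt h e e0; apply/near0P.
have e0' : 0 < e%:C by rewrite ltcR.
by apply: filterS (h _ e0') => t; rewrite normc_norm ltcR.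
Qed.

Lemma exprz_ge1 t (l : int) : 0 < t -> t <= 1 -> l <= 0 -> 1 <= t ^ l.
Proof.
move=> t0 t1; case: l => [[|l]|l] // _.
by rewrite NegzE -exprnN invf_ge1 ?exprn_gt0// exprn_ile1// ltW.
Qed.

(** Reads off the Taylor coefficients of the symbol from an asymptotic known on the
    real line only: the constant term of q tends to 0, hence vanishes, and q / X
    satisfies the same hypothesis with n - 1. *)
Lemma poly_littleo_eq0 n (q : {poly R[i]}) : (size q <= n.+1)%N ->
  (forall e, 0 < e -> exists2 d, 0 < d &
    forall t, t != 0 -> `|t| < d -> normc q.[t%:C] <= e * `|t| ^+ n) -> q = 0.
Proof.
elim: n q => [|n ih] q sq h.
  rewrite (size1_polyC sq); set c := q`_0.
  suff -> : c = 0 by [].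
  apply/ComplexField.Normc.eq0_normc/eqP; rewrite eq_le normc_ge0 andbT.
  apply/ler_addgt0Pr => e e0; rewrite add0r.
  have [d d0 hd] := h _ e0.
  have := hd (d / 2); rewrite (size1_polyC sq) hornerC expr0 mulr1; apply.
    by rewrite gt_eqF ?divr_gt0.
  by rewrite gtr0_norm ?divr_gt0//; lra.
elim/poly_ind: q sq h => // p c _ sq h.
have [A A0 pA] : exists2 A, 0 < A & forall t, `|t| <= 1 -> normc p.[t%:C] <= A.
  exists (1 + \sum_(i < size p) normc p`_i).
    by rewrite ltr_pwDl// sumr_ge0// => i _; exact: normc_ge0.
  move=> t t1; rewrite horner_coef.
  apply: le_trans (normc_sum _ _ _) _; rewrite ler_wpDl//; apply: ler_sum => i _.
  rewrite normcM normcX normc_real ler_piMr ?normc_ge0//.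
  exact: exprn_ile1.
have c0 : c = 0.
  apply/ComplexField.Normc.eq0_normc/eqP; rewrite eq_le normc_ge0 andbT.
  apply/ler_addgt0Pr => e e0; rewrite add0r.
  have [d d0 hd] := h _ ltr01.
  pose t := Num.min (d / 2) (Num.min 1 (e / (1 + A))).
  have t0 : 0 < t by rewrite !lt_min ltr01 !divr_gt0//; lra.
  have td : t <= d / 2 by rewrite !ge_min lexx.
  have t1 : t <= 1 by rewrite !ge_min lexx orbT.
  have te : t <= e / (1 + A) by rewrite !ge_min lexx !orbT.
  have -> : c = (p * 'X + c%:P).[t%:C] - p.[t%:C] * t%:C by rewrite !hornerE; ring.
  have ht : normc (p * 'X + c%:P).[t%:C] <= t.
    apply: le_trans (hd t _ _) _; rewrite ?gt_eqF ?gtr0_norm//; first by lra.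
    by rewrite mul1r exprS ler_piMr ?(ltW t0)// exprn_ile1 ?(ltW t0).
  apply: le_trans (normcB _ _) _; rewrite normcM normc_real gtr0_norm//.
  have hp : normc p.[t%:C] * t <= A * t.
    by rewrite ler_wpM2r ?(ltW t0)//; apply: pA; rewrite gtr0_norm.
  move: te; rewrite ler_pdivlMr; last by lra.
  by lra.
rewrite c0 addr0 in sq h *; suff -> : p = 0 by rewrite mul0r.
apply: ih.
  have [->|p0] := eqVneq p 0; first by rewrite size_poly0.
  by move: sq; rewrite size_mulX.
move=> e e0; have [d d0 hd] := h _ e0; exists d => // t t0 td.
have := hd t t0 td; rewrite hornerMX normcM normc_real exprSr mulrA.
by rewrite ler_pM2r// normr_gt0.
Qed.

Variables (phi : int -> R[i]) (L : nat).
Local Notation P := (symbol phi L).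

Definition moment j : R[i] := \sum_(i < L.*2.+1)
  phi (i%:Z - L%:Z) * (('i * (i%:Z - L%:Z)%:~R) ^+ j / j`!%:R).

Lemma symbol_taylor k B : exists2 C, 0 < C &
  forall z, normc z <= B ->
    normc (P z - \sum_(j < k) moment j * z ^+ j) <= C * normc z ^+ k.
Proof.
pose c0 := 2 ^+ k * L%:R ^+ k * expR (L%:R * B).
have c0_ge0 : 0 <= c0 by rewrite !mulr_ge0 ?exprn_ge0 ?expR_ge0 ?ler0n.
exists (1 + \sum_(i < L.*2.+1) normc (phi (i%:Z - L%:Z)) * c0).
  by rewrite ltr_pwDl// sumr_ge0// => i _; rewrite mulr_ge0 ?normc_ge0.
move=> z zB.
under [in X in _ - X]eq_bigr do rewrite mulr_suml.
rewrite exchange_big -sumrB mulrDl mul1r.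
apply: le_trans (normc_sum _ _ _) _; rewrite ler_wpDl ?exprn_ge0 ?normc_ge0//.
rewrite mulr_suml; apply: ler_sum => i _.
set u := 'i * (i%:Z - L%:Z)%:~R.
under eq_bigr do rewrite -mulrA.
rewrite -mulr_sumr -mulrBr normcM -mulrA ler_wpM2l ?normc_ge0//.
have -> : \sum_(j < k) u ^+ j / j`!%:R * z ^+ j =
          \sum_(j < k) (u * z) ^+ j / j`!%:R.
  by apply: eq_bigr => j _; rewrite [(u * z) ^+ j]exprMn mulrAC.
apply: le_trans (cexp_taylor _ _) _.
have uL : normc u <= L%:R.
  rewrite /u normcM normc_i normr1 mul1r -(rmorph_int (real_complex R)).
  rewrite normc_real -intr_norm -[L%:R]/(L%:Z%:~R) ler_int.
  by have := ltn_ord i; lia.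
have uz : normc (u * z) <= L%:R * normc z.
  by rewrite normcM ler_wpM2r ?normc_ge0.
have -> : c0 * normc z ^+ k =
    2 ^+ k * (L%:R * normc z) ^+ k * expR (L%:R * B) by rewrite /c0 exprMn; ring.
apply: ler_pM; rewrite ?mulr_ge0 ?exprn_ge0 ?expR_ge0 ?normc_ge0//.
  by rewrite ler_wpM2l ?exprn_ge0// lerXn2r ?nnegrE ?normc_ge0 ?mulr_ge0 ?normc_ge0.
by rewrite ler_expR (le_trans uz)// ler_wpM2l.
Qed.

Hypothesis P0 : P 0 = 1.

Lemma moment0 : moment 0 = 1.
Proof.
rewrite -P0; apply: eq_bigr => i _.
by rewrite expr0 mulr0 cexp0 fact0 divr1.
Qed.

Variables (gamma : R[i]) (nu : int) (eps : R -> R[i]).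
Hypothesis gamma_gt0 : 0 < Re gamma.
Hypothesis nu_even : (2 %| nu)%Z.
Hypothesis eps0 : (eps t : R[i]^o) @[t --> (0 : R)^'] --> (0 : R[i]^o).
Hypothesis Pnu : \forall t \near (0 : R)^',
  P t%:C = cexp (- gamma * (t ^ nu)%:C * (1 + eps t)).

Lemma gamma_norm_gt0 : 0 < normc gamma.
Proof. exact: lt_le_trans (lt_le_trans gamma_gt0 (ler_norm _)) (Re_le_normc _). Qed.

(** For nu at most 0 the asymptotic would keep the modulus of the symbol away
    from 1 near the origin, where it tends to 1. *)
Lemma exponent_ge2 : exists v : nat, [/\ nu = v%:Z, (2 <= v)%N & ~~ odd v].
Proof.
suff nu0 : 0 < nu by exists (absz nu); split; lia.
rewrite ltNge; apply/negP => nu0.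
have := gamma_gt0; set a := Re gamma => a0.
have g0 := gamma_norm_gt0.
have [C C0 hC] := symbol_taylor 1 1.
have e0 : 0 < a / 2 / normc gamma by rewrite !divr_gt0.
have [d1 d10 h1] := cvg0P eps0 e0.
move/near0P: Pnu => [d2 d20 h2].
have lt1 : expR (- (a / 2)) < 1 by rewrite expR_lt1; lra.
pose b := (1 - expR (- (a / 2))) / (2 * C).
have b0 : 0 < b by rewrite divr_gt0 ?mulr_gt0//; lra.
pose t := Num.min (Num.min (d1 / 2) (d2 / 2)) (Num.min 1 b).
have t0 : 0 < t by rewrite !lt_min ltr01 b0 !divr_gt0.
have td1 : t <= d1 / 2 by rewrite !ge_min lexx.
have td2 : t <= d2 / 2 by rewrite !ge_min lexx orbT.
have t1 : t <= 1 by rewrite !ge_min lexx !orbT.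
have tb : t <= b by rewrite !ge_min lexx !orbT.
have tn : `|t| = t by rewrite gtr0_norm.
have := hC t%:C; rewrite big_ord1 moment0 expr0 mul1r expr1 normc_real tn => /(_ t1).
have Pt : normc (P t%:C) <= expR (- (a / 2)).
  rewrite h2 ?gt_eqF ?tn//; last by lra.
  rewrite normc_cexp ler_expR.
  have tnu : 1 <= t ^ nu := exprz_ge1 t0 t1 nu0.
  have he : normc (gamma * eps t) <= a / 2.
    rewrite normcM mulrC -ler_pdivlMr// ltW// h1 ?gt_eqF ?tn//; lra.
  have hr : a / 2 <= Re (gamma * (1 + eps t)).
    rewrite mulrDr mulr1 ReD -/a.
    have := le_trans (Re_le_normc _) he; rewrite ler_norml => /andP[]; lra.
  have -> : Re (- gamma * (t ^ nu)%:C * (1 + eps t)) =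
      - (t ^ nu * Re (gamma * (1 + eps t))).
    by rewrite !(ReM, ImM, ReN, ImN)/=; ring.
  by rewrite lerN2; nra.
have : 1 <= normc (P t%:C - 1) + normc (P t%:C).
  rewrite -[X in X <= _](normc1 R) normcBC -{1}(subrK (P t%:C) 1); exact: normcD.
by move: tb; rewrite /b ler_pdivlMr ?mulr_gt0//; lra.
Qed.

Variable v : nat.
Hypothesis nuE : nu = v%:Z.
Hypothesis v2 : (2 <= v)%N.

Lemma symbol_littleo e : 0 < e -> exists2 d, 0 < d &
  forall t, t != 0 -> `|t| < d ->
    normc (P t%:C - 1 + gamma * t%:C ^+ v) <= e * `|t| ^+ v.
Proof.
move=> e0; have g0 := gamma_norm_gt0; set g := normc gamma in g0.
pose e1 := Num.min 1 (e / 2 / g).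
have e10 : 0 < e1 by rewrite lt_min ltr01 !divr_gt0.
have [d1 d10 h1] := cvg0P eps0 e10.
move/near0P: Pnu => [d2 d20 h2].
pose K := 16 * g ^+ 2 * expR (2 * g).
have K0 : 0 < K by rewrite !mulr_gt0 ?exprn_gt0 ?expR_gt0.
exists (Num.min (Num.min d1 d2) (Num.min 1 (e / 2 / K))).
  by rewrite !lt_min d10 d20 ltr01 !divr_gt0.
move=> t t0; rewrite !lt_min => /andP[/andP[td1 td2] /andP[t1 te]].
rewrite h2// nuE -exprnP.
have := h1 t t0 td1; rewrite lt_min => /andP[ep1 ep2].
set w := - gamma * _ * _.
have tv0 : 0 <= `|t| ^+ v by rewrite exprn_ge0.
have tv1 : `|t| ^+ v <= 1 by rewrite exprn_ile1// ltW.
have nw : normc w <= 2 * g * `|t| ^+ v.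
  rewrite /w !normcM normcN normc_real normrX -/g mulrC mulrA.
  rewrite ler_wpM2r// ler_wpM2r ?ltW//.
  by have := normcD 1 (eps t); rewrite normc1; lra.
have nw2 : normc w <= 2 * g by apply: le_trans nw _; rewrite ler_piMr// mulr_ge0// ltW.
have := cexp_taylor 2 w; rewrite !big_ord_recl big_ord0 /= !expr0 !expr1 => ht.
have -> : cexp w - 1 + gamma * t%:C ^+ v =
  (cexp w - (1 / 0`!%:R + (w / (bump 0 0)`!%:R + 0))) + (- gamma * (t ^+ v)%:C * eps t).
  by rewrite /bump /= fact0 factS fact0 mul1n !divr1 rmorphXn /w rmorphXn /=; ring.
apply: le_trans (normcD _ _) _.
have b1 : normc (- gamma * (t ^+ v)%:C * eps t) <= e / 2 * `|t| ^+ v.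
  rewrite !normcM normcN normc_real normrX -/g mulrAC ler_wpM2r// mulrC.
  by rewrite -ler_pdivlMr// ltW.
have b2 : normc w ^+ 2 <= 4 * g ^+ 2 * (`|t| ^+ v * `|t|).
  apply: (@le_trans _ _ ((2 * g * `|t| ^+ v) ^+ 2)).
    by rewrite lerXn2r ?nnegrE ?normc_ge0 ?mulr_ge0 ?(ltW g0).
  have -> : (2 * g * `|t| ^+ v) ^+ 2 = 4 * g ^+ 2 * (`|t| ^+ v * `|t| ^+ v) by ring.
  rewrite ler_wpM2l ?mulr_ge0 ?exprn_ge0 ?(ltW g0)// ler_wpM2l//.
  by case: (v) v2 => // u _; rewrite exprS ler_piMr// exprn_ile1// ltW.
have b3 : 2 ^+ 2 * normc w ^+ 2 * expR (normc w) <= K * `|t| * `|t| ^+ v.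
  have -> : K * `|t| * `|t| ^+ v =
    2 ^+ 2 * (4 * g ^+ 2 * (`|t| ^+ v * `|t|)) * expR (2 * g) by rewrite /K; ring.
  apply: ler_pM; rewrite ?mulr_ge0 ?exprn_ge0 ?normc_ge0 ?expR_ge0//.
    by rewrite ler_wpM2l.
  by rewrite ler_expR.
have b4 : K * `|t| * `|t| ^+ v <= e / 2 * `|t| ^+ v.
  by rewrite ler_wpM2r// mulrC -ler_pdivlMr// ltW.
by lra.
Qed.

(** The hypothesis is a little-o on the real line. It determines the moments up to
    order v, and the Taylor remainder of the entire function P then gives the next
    order in the whole complex plane. *)
Lemma symbol_expansion B : exists2 C, 0 < C &
  forall z, normc z <= B ->
    normc (P z - 1 + gamma * z ^+ v) <= C * normc z ^+ v.+1.
Proof.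
pose q : {poly R[i]} :=
  \sum_(j < v.+1) moment j *: 'X^j - 1 + gamma *: 'X^v.
have qE z : q.[z] = \sum_(j < v.+1) moment j * z ^+ j - 1 + gamma * z ^+ v.
  rewrite !hornerE horner_sum; congr (_ - _ + _).
  by apply: eq_bigr => j _; rewrite !hornerE.
suff q0 : q = 0.
  have [C C0 h] := symbol_taylor v.+1 B; exists C => // z zB.
  apply: le_trans (h z zB); rewrite le_eqVlt; apply/orP; left; apply/eqP.
  congr normc; have := qE z; rewrite q0 horner0 => /esym h0.
  by rewrite -[LHS]subr0 -[in LHS]h0; ring.
apply: (@poly_littleo_eq0 v).
  rewrite /q; apply: leq_trans (size_polyD _ _) _; rewrite geq_max; apply/andP; split.
    apply: leq_trans (size_polyD _ _) _; rewrite geq_max size_polyN size_poly1 andbT.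
    apply: (leq_trans (size_sum _ _ _)); apply/bigmax_leqP => j _.
    by apply: leq_trans (size_scale_leq _ _) _; rewrite size_polyXn.
  by apply: leq_trans (size_scale_leq _ _) _; rewrite size_polyXn.
move=> e e0; have [C C0 h] := symbol_taylor v.+1 1.
have e2 : 0 < e / 2 by lra.
have [d d0 hd] := symbol_littleo e2.
exists (Num.min d (Num.min 1 (e / 2 / C))).
  by rewrite !lt_min d0 ltr01 !divr_gt0.
move=> t t0; rewrite !lt_min => /and3P[td t1 te].
have -> : q.[t%:C] = (P t%:C - 1 + gamma * t%:C ^+ v) -
    (P t%:C - \sum_(j < v.+1) moment j * t%:C ^+ j) by rewrite qE; ring.
apply: le_trans (normcB _ _) _.
have := hd t t0 td; have := h t%:C; rewrite normc_real => /(_ (ltW t1)).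
have : C * `|t| ^+ v.+1 <= e / 2 * `|t| ^+ v.
  rewrite exprS mulrA ler_wpM2r ?exprn_ge0// mulrC -ler_pdivlMr// ltW//.
by lra.
Qed.

End Expansion.

(** * The symbol off the real axis *)

Section SymbolBound.
Variable R : realType.
Implicit Types (z w : R[i]) (t s e : R).

Lemma normr_even_exp (x : R) v : ~~ odd v -> `|x| ^+ v = x ^+ v.
Proof.
move=> ev; rewrite -(odd_double_half v) (negbTE ev) add0n -mul2n.
by rewrite !exprM real_normK// num_real.
Qed.

Lemma normc_cexp_sub1 w : normc (cexp w - 1) <= 2 * normc w * expR (normc w).
Proof.
have := cexp_taylor 1 w.
by rewrite big_ord1 expr0 fact0 divr1 !expr1.
Qed.

Lemma normc_subX_le z t v : normc (z - t%:C) <= `|t| ->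
  normc (z ^+ v - t%:C ^+ v) <= normc (z - t%:C) * (v%:R * (2 * `|t|) ^+ v.-1).
Proof.
move=> zt; rewrite subrXX normcM ler_wpM2l ?normc_ge0//.
apply: le_trans (normc_sum _ _ _) _.
have zn : normc z <= 2 * `|t|.
  by rewrite -(subrK t%:C z); apply: le_trans (normcD _ _) _; rewrite normc_real; lra.
have -> : v%:R * (2 * `|t|) ^+ v.-1 = \sum_(i < v) (2 * `|t|) ^+ v.-1.
  by rewrite sumr_const card_ord mulr_natl.
apply: ler_sum => i _; rewrite normcM !normcX normc_real.
have -> : (2 * `|t|) ^+ v.-1 = (2 * `|t|) ^+ (v.-1 - i) * (2 * `|t|) ^+ i.
  by rewrite -exprD; congr (_ ^+ _); have := ltn_ord i; clear; lia.
have t0 := normr_ge0 t.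
apply: ler_pM; rewrite ?exprn_ge0 ?normc_ge0//.
  by rewrite lerXn2r ?nnegrE ?normc_ge0 ?mulr_ge0.
by rewrite lerXn2r ?nnegrE ?mulr_ge0//; lra.
Qed.

(** Compactness, applied to the squared modulus, which is polynomial in the two
    components and so continuous without appeal to the square root. *)
Lemma curve_lt1 (f df : R -> R[i]) (a b : R) : (forall t, cderive f t (df t)) ->
  (forall t, t \in `[a, b] -> normc (f t) < 1) ->
  exists2 eta, eta < 1 & forall t, t \in `[a, b] -> normc (f t) <= eta.
Proof.
move=> fd f1; have [ab|ba] := leP a b; last first.
  exists 0 => // t; rewrite in_itv /= => /andP[h1 h2].
  by have := le_trans h1 h2; rewrite leNgt ba.
have cont (g dg : R -> R) : (forall t, is_derive t (1 : R) g (dg t)) -> continuous g.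
  move=> gd x; apply: differentiable_continuous.
  by apply/derivable1_diffP; exact: ex_derive.
have cRe := cont _ _ (fun t => (fd t).1).
have cIm := cont _ _ (fun t => (fd t).2).
pose g t := Re (f t) * Re (f t) + Im (f t) * Im (f t).
have gE t : g t = normc (f t) ^+ 2.
  by rewrite /g; case: (f t) => x y /=; rewrite sqr_sqrtr ?addr_ge0 ?sqr_ge0// !expr2.
have cg : continuous g.
  by move=> x; apply: cvgD; apply: cvgM; (exact: cRe || exact: cIm).
have [c cab hc] := EVT_max ab (continuous_subspaceT cg).
exists ((1 + g c) / 2).
  have := f1 c cab; rewrite gE; have := normc_ge0 (f c).
  by move: (normc _) => x; nra.
move=> t /hc; rewrite (gE t); have := sqr_ge0 (normc (f t) - 1).
by move: (normc _) (g c) => x y; lra.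
Qed.

Variables (phi : int -> R[i]) (L : nat).
Local Notation P := (symbol phi L).

Definition mass : R := \sum_(i < L.*2.+1) normc (phi (i%:Z - L%:Z)).

Lemma mass_ge0 : 0 <= mass.
Proof. by rewrite sumr_ge0// => i _; exact: normc_ge0. Qed.

Let norm_shift (i : 'I_L.*2.+1) : `|(i%:Z - L%:Z)%:~R| <= L%:R :> R.
Proof.
rewrite -intr_norm -[L%:R]/(L%:Z%:~R) ler_int.
by have := ltn_ord i; lia.
Qed.

Lemma symbol_cderive t : cderive (fun u => P u%:C) t
  (\sum_(i < L.*2.+1) phi (i%:Z - L%:Z) *
    ('i * (i%:Z - L%:Z)%:~R * cexp ('i * (i%:Z - L%:Z)%:~R * t%:C))).
Proof.
apply: cderive_sum => i; apply: cderiveZ; apply: cderive_cexp.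
by apply: cderive_eq (cderiveZ _ (cderive_id t)) _; rewrite mulr1.
Qed.

Lemma symbol_growth t s : normc (P (t +i* s)) <= mass * expR (L%:R * `|s|).
Proof.
rewrite mulr_suml; apply: le_trans (normc_sum _ _ _) _; apply: ler_sum => i _.
rewrite normcM ler_wpM2l ?normc_ge0// normc_cexp ler_expR.
have -> : Re ('i * (i%:Z - L%:Z)%:~R * (t +i* s)) = - ((i%:Z - L%:Z)%:~R * s).
  by rewrite -(rmorph_int (real_complex R)) !(ReM, ImM)/=; ring.
apply: le_trans (ler_norm _) _; rewrite normrN normrM ler_wpM2r//; exact: norm_shift.
Qed.

Lemma symbol_vertical t s : `|s| <= 1 ->
  normc (P (t +i* s) - P t%:C) <= mass * (2 * L%:R * expR L%:R) * `|s|.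
Proof.
move=> s1; rewrite /symbol -sumrB -mulrA mulr_suml.
apply: le_trans (normc_sum _ _ _) _; apply: ler_sum => i _.
rewrite -mulrBr normcM ler_wpM2l ?normc_ge0//.
have := norm_shift i; set l := (i%:Z - L%:Z)%:~R => lL.
have -> : (i%:Z - L%:Z)%:~R = l%:C :> R[i] by rewrite (rmorph_int (real_complex R)).
have -> : 'i * l%:C * (t +i* s) = 'i * l%:C * t%:C + (- (l * s))%:C.
  by apply: complexP; rewrite !(ReD, ImD, ReM, ImM)/=; ring.
rewrite cexpD -[X in _ - X]mulr1 -mulrBr normcM normc_cexp.
have -> : Re ('i * l%:C * t%:C) = 0 by rewrite !(ReM, ImM)/=; ring.
rewrite expR0 mul1r; apply: le_trans (normc_cexp_sub1 _) _.
rewrite normc_real normrN normrM.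
have ls : `|l| * `|s| <= L%:R * `|s| by rewrite ler_wpM2r.
have -> : 2 * L%:R * expR L%:R * `|s| = 2 * (L%:R * `|s|) * expR L%:R by ring.
apply: ler_pM; rewrite ?mulr_ge0 ?expR_ge0// ?ler_pM2l//.
by rewrite ler_expR (le_trans ls)// ler_piMr.
Qed.

Variables (gamma : R[i]) (v : nat).
Hypothesis gamma_gt0 : 0 < Re gamma.
Hypothesis v2 : (2 <= v)%N.
Hypothesis v_even : ~~ odd v.
Hypothesis expansion : forall B, exists2 C, 0 < C &
  forall z, normc z <= B -> normc (P z - 1 + gamma * z ^+ v) <= C * normc z ^+ v.+1.
Hypothesis P_lt1 : forall t, 0 < `|t| <= pi -> normc (P t%:C) < 1.

Lemma normc_1B_gamma (u : R) : 0 <= u -> normc gamma ^+ 2 * u <= Re gamma ->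
  normc (1 - gamma * u%:C) <= 1 - Re gamma / 2 * u.
Proof.
move=> u0 gu; have a0 := gamma_gt0.
have g2 : normc gamma ^+ 2 = Re gamma ^+ 2 + Im gamma ^+ 2.
  by case: (gamma) => x y /=; rewrite sqr_sqrtr// addr_ge0 ?sqr_ge0.
have au : Re gamma * u <= 1.
  by move: gu; rewrite g2; have := sqr_ge0 (Im gamma); nra.
rewrite -(ler_pXn2r (_ : 0 < 2)%N) ?nnegrE ?normc_ge0//; last by lra.
have -> : normc (1 - gamma * u%:C) ^+ 2 =
    1 - 2 * Re gamma * u + normc gamma ^+ 2 * u ^+ 2.
  rewrite g2; case: (gamma) => x y /=.
  by rewrite sqr_sqrtr ?addr_ge0 ?sqr_ge0//; ring.
by have := ler_wpM2r u0 gu; nra.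
Qed.

(** Near the origin the term of degree v decides. If s is small compared with t,
    the modulus is that on the real line up to a small relative error; otherwise
    a power of s absorbs everything. *)
Lemma symbol_bound_near : exists r c C, [/\ 0 < r, r <= 1, 0 < c, 0 < C &
  forall t s, `|t| <= r -> `|s| <= r ->
    normc (P (t +i* s)) <= expR (- (c * `|t| ^+ v) + C * `|s| ^+ v)].
Proof.
have a0 := gamma_gt0; set a := Re gamma in a0.
have g0 : 0 < normc gamma := gamma_norm_gt0 gamma_gt0.
set g := normc gamma in g0.
have [C1 C10 hC] := expansion 2.
(* dl controls the error z ^ v - t ^ v and r the remainder of the expansion: each
   costs at most a / 8 out of the a / 2 gained by the main term. *)
pose dl := Num.min 1 (a / 8 / (g * (v%:R * 2 ^+ v))).
have v0 : 0 < v%:R * 2 ^+ v :> R.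
  by rewrite mulr_gt0 ?exprn_gt0// ltr0n; apply: leq_trans v2.
have dl0 : 0 < dl by rewrite lt_min ltr01 !divr_gt0// (mulr_gt0 g0 v0).
have dl1 : dl <= 1 by rewrite ge_min lexx.
have dl2 : g * dl * (v%:R * 2 ^+ v) <= a / 8.
  by rewrite mulrAC mulrC -ler_pdivlMr ?(mulr_gt0 g0 v0)// ge_min lexx orbT.
pose r := Num.min 1 (Num.min (a / 8 / (C1 * 2 ^+ v.+1)) (a / g ^+ 2)).
have r0 : 0 < r by rewrite !lt_min ltr01 !divr_gt0 ?mulr_gt0 ?exprn_gt0.
have r1 : r <= 1 by rewrite ge_min lexx.
have r2 : C1 * 2 ^+ v.+1 * r <= a / 8.
  by rewrite mulrC -ler_pdivlMr ?mulr_gt0 ?exprn_gt0// !ge_min lexx !orbT.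
have r3 : g ^+ 2 * r <= a.
  by rewrite mulrC -ler_pdivlMr ?exprn_gt0// !ge_min lexx !orbT.
pose A := (g + 2 * C1) * (1 + dl^-1) ^+ v.
have A0 : 0 < A by rewrite mulr_gt0 ?exprn_gt0//; [lra|rewrite addr_gt0// invr_gt0].
have B0 : 0 < A + a / 4 * (dl^-1) ^+ v.
  by rewrite addr_gt0// mulr_gt0 ?exprn_gt0 ?invr_gt0//; lra.
exists r, (a / 4), (A + a / 4 * (dl^-1) ^+ v); split => //; first by lra.
move=> t s tr sr.
have tv0 : 0 <= `|t| ^+ v by rewrite exprn_ge0.
have sv0 : 0 <= `|s| ^+ v by rewrite exprn_ge0.
set z := t +i* s.
have zt : normc (z - t%:C) = `|s|.
  have -> : z - t%:C = s *i by apply: complexP; rewrite ?(ReD, ReN, ImD, ImN) /=; ring.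
  exact: normc_i.
have zn : normc z <= `|t| + `|s|.
  by rewrite -(subrK t%:C z) addrC; apply: le_trans (normcD _ _) _; rewrite normc_real zt.
have z2 : normc z <= 2 by lra.
have hz := hC z z2.
have [st|st] := leP `|s| (dl * `|t|).
  have st' : `|s| <= `|t| by apply: le_trans st _; rewrite ler_piMl.
  have hzt : normc (z ^+ v - t%:C ^+ v) <= dl * (v%:R * 2 ^+ v) * `|t| ^+ v.
    apply: le_trans (normc_subX_le _ _) _; rewrite zt//.
    apply: le_trans (ler_wpM2r _ st) _; rewrite ?mulr_ge0 ?exprn_ge0 ?ler0n//.
    case: (v) v2 => // u _ /=.
    have -> : dl * (u.+1%:R * 2 ^+ u.+1) * `|t| ^+ u.+1 =
      2 * (dl * `|t| * (u.+1%:R * (2 * `|t|) ^+ u)) by rewrite exprMn !exprS; ring.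
    rewrite ler_peMl ?mulr_ge0 ?exprn_ge0 ?(ltW dl0) ?ler0n//; lra.
  have hv : normc z ^+ v.+1 <= 2 ^+ v.+1 * r * `|t| ^+ v.
    apply: (@le_trans _ _ ((2 * `|t|) ^+ v.+1)).
      rewrite lerXn2r ?nnegrE ?normc_ge0 ?mulr_ge0//; lra.
    rewrite exprMn [`|t| ^+ v.+1]exprS -mulrA ler_wpM2l ?exprn_ge0//.
    by rewrite ler_wpM2r.
  have h1 : normc (1 - gamma * (`|t| ^+ v)%:C) <= 1 - a / 2 * `|t| ^+ v.
    apply: normc_1B_gamma => //; apply: le_trans r3.
    rewrite ler_wpM2l ?exprn_ge0 ?(ltW g0)//; apply: (le_trans _ tr).
    by case: (v) v2 => // u _; rewrite exprS ler_piMr// exprn_ile1// (le_trans tr).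
  have tC : (`|t| ^+ v)%:C = t%:C ^+ v by rewrite normr_even_exp// rmorphXn.
  have PE : P z = (1 - gamma * (`|t| ^+ v)%:C) - gamma * (z ^+ v - t%:C ^+ v) +
      (P z - 1 + gamma * z ^+ v) by rewrite tC; ring.
  have hP : normc (P z) <= 1 - a / 4 * `|t| ^+ v.
    rewrite PE; apply: le_trans (normcD _ _) _.
    have hB := normcB (1 - gamma * (`|t| ^+ v)%:C) (gamma * (z ^+ v - t%:C ^+ v)).
    have hg : normc (gamma * (z ^+ v - t%:C ^+ v)) <= a / 8 * `|t| ^+ v.
      rewrite normcM -/g.
      by have := ler_wpM2r tv0 dl2; have := ler_wpM2l (ltW g0) hzt; lra.
    have hr : C1 * normc z ^+ v.+1 <= a / 8 * `|t| ^+ v.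
      by have := ler_wpM2r tv0 r2; have := ler_wpM2l (ltW C10) hv; lra.
    by lra.
  apply: le_trans hP _; apply: (@le_trans _ _ (expR (- (a / 4 * `|t| ^+ v)))).
    by apply: le_trans (expR_ge1Dx _).
  by rewrite ler_expR lerDl mulr_ge0// ltW.
have st' : `|t| <= dl^-1 * `|s| by rewrite mulrC ler_pdivlMr// mulrC ltW.
have hzv : normc z ^+ v <= (1 + dl^-1) ^+ v * `|s| ^+ v.
  rewrite -exprMn lerXn2r ?nnegrE ?normc_ge0 ?mulr_ge0 ?addr_ge0 ?invr_ge0 ?(ltW dl0)//; lra.
have htv : `|t| ^+ v <= (dl^-1) ^+ v * `|s| ^+ v.
  by rewrite -exprMn lerXn2r ?nnegrE ?mulr_ge0 ?invr_ge0 ?(ltW dl0).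
have hP : normc (P z) <= 1 + A * `|s| ^+ v.
  have -> : P z = 1 - gamma * z ^+ v + (P z - 1 + gamma * z ^+ v) by ring.
  apply: le_trans (normcD _ _) _; have := normcB 1 (gamma * z ^+ v).
  rewrite normc1 normcM normcX -/g.
  have : C1 * normc z ^+ v.+1 <= 2 * C1 * normc z ^+ v.
    by rewrite exprS [2 * C1]mulrC -mulrA ler_wpM2l ?(ltW C10)// ler_wpM2r ?exprn_ge0 ?normc_ge0.
  have : (g + 2 * C1) * normc z ^+ v <= A * `|s| ^+ v.
    by rewrite /A -mulrA ler_wpM2l//; lra.
  by lra.
apply: le_trans hP _; apply: le_trans (expR_ge1Dx _) _; rewrite ler_expR.
have : a / 4 * `|t| ^+ v <= a / 4 * (dl^-1 ^+ v * `|s| ^+ v) by rewrite ler_wpM2l//; lra.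
by lra.
Qed.

(** Compactness on the real line, then continuity in s. *)
Lemma symbol_bound_mid r : 0 < r -> exists eta s0, [/\ 0 < eta, 0 < s0 &
  forall t s, r <= `|t| <= pi -> `|s| <= s0 -> normc (P (t +i* s)) <= expR (- eta)].
Proof.
move=> r0.
have [e1 e11 h1] : exists2 e1, e1 < 1 &
    forall t, t \in `[r, pi] -> normc (P t%:C) <= e1.
  apply: curve_lt1 => [t|t]; first exact: symbol_cderive.
  rewrite in_itv /= => /andP[h1 h2]; apply: P_lt1.
  by rewrite gtr0_norm ?h2 (lt_le_trans r0).
have [e2 e21 h2] : exists2 e2, e2 < 1 &
    forall t, t \in `[- pi, - r] -> normc (P t%:C) <= e2.
  apply: curve_lt1 => [t|t]; first exact: symbol_cderive.
  rewrite in_itv /= => /andP[h2 h3]; apply: P_lt1.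
  by rewrite ltr0_norm; [apply/andP; split; lra|lra].
pose eta := (1 - Num.max e1 e2) / 2.
have eta0 : 0 < eta by rewrite divr_gt0// subr_gt0 gt_max e11.
pose K := mass * (2 * L%:R * expR L%:R) + 1.
have K0 : 0 < K.
  by rewrite ltr_wpDl// mulr_ge0 ?mass_ge0// !mulr_ge0 ?ler0n ?expR_ge0.
exists eta, (Num.min 1 (eta / K)); split => //.
  by rewrite lt_min ltr01 divr_gt0.
move=> t s /andP[rt tpi]; rewrite le_min => /andP[s1 sK].
have hs := symbol_vertical t s1.
have hK : K * `|s| <= eta by rewrite mulrC -ler_pdivlMr.
have ht : normc (P t%:C) <= 1 - 2 * eta.
  have -> : 1 - 2 * eta = Num.max e1 e2 by rewrite /eta; lra.
  rewrite le_max; move: rt tpi; have [t0|t0] := ger0P t => rt tpi.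
    by rewrite h1// in_itv /= rt.
  by rewrite h2 ?orbT// in_itv /=; apply/andP; split; lra.
apply: (@le_trans _ _ (1 - eta)); last exact: expR_ge1Dx.
rewrite -(subrK (P t%:C) (P _)); apply: le_trans (normcD _ _) _.
by have := normr_ge0 s; move: hK; rewrite /K mulrDl; lra.
Qed.

(** Away from the real axis the growth exp (L |s|) is beaten by exp (C |s| ^ v),
    as v is at least 1. *)
Lemma symbol_bound_far s1 : 0 < s1 -> exists2 C, 0 < C &
  forall t s, `|t| <= pi -> s1 <= `|s| ->
    normc (P (t +i* s)) <= expR (- `|t| ^+ v + C * `|s| ^+ v).
Proof.
move=> s10; have m0 := mass_ge0; have p0 := pi_ge0 R.
pose u := v.-1.
have vE : v = u.+1 by rewrite /u prednK// (leq_trans _ v2).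
pose C := 1 + (mass + pi ^+ v) / s1 ^+ v + L%:R / s1 ^+ u.
have C0 : 0 < C.
  by rewrite /C -addrA ltr_pwDl// addr_ge0// divr_ge0 ?addr_ge0 ?exprn_ge0// ltW.
exists C => // t s tpi ss.
apply: le_trans (symbol_growth _ _) _.
apply: (@le_trans _ _ (expR mass * expR (L%:R * `|s|))).
  by rewrite ler_wpM2r ?expR_ge0// (le_trans _ (expR_ge1Dx _))// lerDr.
rewrite -expRD ler_expR.
have sv0 : 0 <= `|s| ^+ v by rewrite exprn_ge0.
have h1 : mass + pi ^+ v <= (mass + pi ^+ v) / s1 ^+ v * `|s| ^+ v.
  rewrite -mulrA ler_peMr ?addr_ge0 ?exprn_ge0//.
  by rewrite mulrC ler_pdivlMr ?exprn_gt0// mul1r lerXn2r// nnegrE ltW.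
have h2 : L%:R * `|s| <= L%:R / s1 ^+ u * `|s| ^+ v.
  rewrite -mulrA ler_wpM2l// vE exprS mulrCA ler_peMr//.
  by rewrite mulrC ler_pdivlMr ?exprn_gt0// mul1r lerXn2r// nnegrE ltW.
have h3 : `|t| ^+ v <= pi ^+ v by rewrite lerXn2r// nnegrE.
by rewrite /C !mulrDl mul1r; lra.
Qed.

Lemma symbol_bound : exists c C, [/\ 0 < c, 0 < C &
  forall t s, `|t| <= pi ->
    normc (P (t +i* s)) <= expR (- (c * `|t| ^+ v) + C * `|s| ^+ v)].
Proof.
have [r [c1 [C1 [r0 _ c10 C10 h1]]]] := symbol_bound_near.
have [eta [s0 [eta0 s00 h2]]] := symbol_bound_mid r0.
have m0 : 0 < Num.min r s0 by rewrite lt_min r0.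
have [C3 C30 h3] := symbol_bound_far m0.
have pv0 : 0 < (pi : R) ^+ v by rewrite exprn_gt0// pi_gt0.
pose c := Num.min c1 (Num.min 1 (eta / pi ^+ v)).
have c0 : 0 < c by rewrite !lt_min c10 ltr01 divr_gt0.
have cc1 : c <= c1 by rewrite ge_min lexx.
have cc2 : c <= 1 by rewrite !ge_min lexx orbT.
have cc3 : c * pi ^+ v <= eta by rewrite -ler_pdivlMr// !ge_min lexx !orbT.
exists c, (C1 + C3); split => //; first by rewrite addr_gt0.
move=> t s tpi.
have tv0 : 0 <= `|t| ^+ v by rewrite exprn_ge0.
have sv0 : 0 <= `|s| ^+ v by rewrite exprn_ge0.
have [sm|sm] := leP (Num.min r s0) `|s|.
  apply: le_trans (h3 _ _ tpi sm) _; rewrite ler_expR mulrDl.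
  by have := mulr_ge0 (ltW C10) sv0; nra.
move: sm; rewrite lt_min => /andP[sr ss0].
have [tr|tr] := leP `|t| r.
  apply: le_trans (h1 _ _ tr (ltW sr)) _; rewrite ler_expR mulrDl.
  by have := mulr_ge0 (ltW C30) sv0; nra.
apply: le_trans (h2 t s _ (ltW ss0)) _; first by rewrite (ltW tr).
rewrite ler_expR.
have h : c * `|t| ^+ v <= c * pi ^+ v.
  by rewrite ler_wpM2l ?(ltW c0)// lerXn2r// nnegrE pi_ge0.
by have := mulr_ge0 (addr_ge0 (ltW C10) (ltW C30)) sv0; lra.
Qed.

End SymbolBound.

(** * Gaussian-type upper bound *)

Section UpperBound.
Variable R : realType.
Implicit Types (s u c h r : R).

Lemma sum_symmetric (V : nmodType) (F : int -> V) K :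
  \sum_(k < K.*2.+1) F (k%:Z - K%:Z) =
  F 0 + \sum_(k < K) (F k.+1%:Z + F (- k.+1%:Z)).
Proof.
elim: K => [|K ih]; first by rewrite double0 big_ord1 big_ord0 [RHS]addr0; congr (F _); lia.
transitivity (F (- K.+1%:Z) + (\sum_(k < K.*2.+1) F (k%:Z - K%:Z) + F K.+1%:Z)).
  rewrite doubleS big_ord_recl big_ord_recr; congr (F _ + (_ + F _)).
  - by rewrite /=; lia.
  - by apply: eq_bigr => i _; congr (F _); rewrite lift0 /=; lia.
  - by rewrite lift0 /=; lia.
by rewrite ih [in RHS]big_ord_recr /= addrC -!addrA.
Qed.

(** The summand is dominated by a telescoping difference. *)
Lemma sum_inv_sqr_le h K : 0 < h ->
  \sum_(k < K) (1 + k.+1%:R * h) ^- 2 <= h^-1.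
Proof.
move=> h0; have pos (k : nat) : 0 < 1 + k%:R * h.
  by rewrite ltr_pwDl// mulr_ge0// ltW.
suff : \sum_(k < K) (1 + k.+1%:R * h) ^- 2 <= h^-1 * (1 - (1 + K%:R * h)^-1).
  move/le_trans; apply; rewrite ler_piMr ?invr_ge0 ?(ltW h0)//.
  by rewrite gerBl invr_ge0 ltW.
elim: K => [|K ih]; first by rewrite big_ord0 mul0r addr0 invr1 subrr mulr0.
rewrite big_ord_recr /=; apply: le_trans (lerD ih (lexx _)) _.
rewrite -lerBrDl -mulrBr.
have -> : h^-1 * (1 - (1 + K.+1%:R * h)^-1 - (1 - (1 + K%:R * h)^-1)) =
          (1 + K.+1%:R * h)^-1 * (1 + K%:R * h)^-1.
  have := pos K; have := pos K.+1; rewrite -natr1 => p1 p2.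
  by field; rewrite !gt_eqF.
rewrite expr2 invfM ler_pM2l ?invr_gt0// lef_pV2 ?posrE//.
by rewrite lerD2l ler_wpM2r ?(ltW h0)// ler_nat.
Qed.

Lemma sum_decay_le h K : 0 < h ->
  \sum_(k < K.*2.+1) (1 + `|(k%:Z - K%:Z)%:~R| * h) ^- 2 <= 1 + 2 * h^-1.
Proof.
move=> h0.
rewrite (sum_symmetric (fun l : int => (1 + `|l%:~R| * h) ^- 2)).
rewrite normr0 mul0r addr0 expr1n invr1 lerD2l big_split /=.
have -> : 2 * h^-1 = h^-1 + h^-1 by ring.
apply: lerD; apply: le_trans (sum_inv_sqr_le K h0).
  by apply: ler_sum => k _; rewrite -pmulrn normr_nat.
by apply: ler_sum => k _; rewrite mulrNz normrN -pmulrn normr_nat.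
Qed.

(** As u ^ v >= u - 1, the exponential may be taken of rate c; then 1 + u is
    compared with an exponential of rate c / (j + 1), and the power j + 1 of this
    comparison absorbs the decay exactly. *)
Lemma poly_exp_bounded (v j : nat) c : (0 < v)%N -> 0 < c ->
  exists2 B, 0 < B & forall u, 0 <= u -> (1 + u) ^+ j * expR (- (c * u ^+ v)) <= B.
Proof.
move=> v0 c0; pose c' := c / j.+1%:R; pose A := Num.max 1 (c'^-1).
have c'0 : 0 < c' by rewrite divr_gt0.
have A1 : 1 <= A by rewrite le_max lexx.
have Ac : 1 <= A * c' by rewrite -ler_pdivrMr// mul1r le_max lexx orbT.
exists (expR c * A ^+ j.+1).
  by rewrite mulr_gt0 ?expR_gt0 ?exprn_gt0//; lra.
move=> u u0.
have h1 : 1 + u <= A * expR (c' * u).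
  apply: (@le_trans _ _ (A * (1 + c' * u))); last by rewrite ler_wpM2l ?expR_ge1Dx//; lra.
  by have := ler_wpM2r u0 Ac; lra.
have h2 : u - 1 <= u ^+ v.
  have [u1|u1] := leP u 1; first by apply: (@le_trans _ _ 0); rewrite ?exprn_ge0//; lra.
  apply: (@le_trans _ _ u); first by lra.
  by rewrite ler_eXnr// ltW.
have h3 : expR (- (c * u ^+ v)) <= expR c * expR (- (c * u)).
  rewrite -expRD ler_expR; have := ler_wpM2l (ltW c0) h2; lra.
apply: (@le_trans _ _ ((1 + u) ^+ j.+1 * expR (- (c * u ^+ v)))).
  by rewrite ler_wpM2r ?expR_ge0// ler_weXn2l//; lra.
apply: (@le_trans _ _ ((A * expR (c' * u)) ^+ j.+1 * (expR c * expR (- (c * u))))).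
  apply: ler_pM; rewrite ?exprn_ge0 ?expR_ge0//; first by lra.
  by rewrite lerXn2r// nnegrE; [lra | rewrite mulr_ge0 ?expR_ge0//; lra].
have -> : (A * expR (c' * u)) ^+ j.+1 = A ^+ j.+1 * expR (c * u).
  rewrite exprMn -expRM_natl; congr (_ * expR _).
  by rewrite /c'; field; rewrite gt_eqF//; lra.
by rewrite expRN mulrCA mulfK// gt_eqF// expR_gt0.
Qed.

Lemma decay_exists (v j : nat) c : (0 < v)%N -> 0 < c ->
  exists2 B, 0 < B & forall u, 0 <= u ->
    (1 + u) ^+ j * expR (- (c * u ^+ v)) <= B * (1 + u) ^- 2.
Proof.
move=> v0 c0; have [B B0 hB] := poly_exp_bounded j.+2 v0 c0; exists B => // u u0.
have u1 : 0 < (1 + u) ^+ 2 by rewrite exprn_gt0//; lra.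
by rewrite ler_pdivlMr// mulrAC -exprD addn2 hB.
Qed.

(** The mesh of the frequencies once they are multiplied by r. *)
Definition step (K : nat) r : R := 2 * pi * r / K.*2.+1%:R.

Lemma step_gt0 K r : 0 < r -> 0 < step K r.
Proof. by move=> r0; rewrite divr_gt0 ?mulr_gt0 ?pi_gt0. Qed.

Lemma freq_step K k r : r * freq R K k = step K r * (k%:Z - K%:Z)%:~R.
Proof. by rewrite /freq /step rmorphB /= -!pmulrn; ring. Qed.

Lemma freq_le_pi K k : (k < K.*2.+1)%N -> `|freq R K k| <= pi.
Proof.
move=> kK; rewrite /freq !normrM normfV normr_nat (gtr0_norm (pi_gt0 R)) normr_nat.
rewrite ler_pdivrMr// mulrAC mulrC ler_wpM2l ?pi_ge0//.
have -> : k%:R - K%:R = (k%:Z - K%:Z)%:~R :> R by rewrite rmorphB /= -!pmulrn.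
have -> : K.*2.+1%:R = K.*2.+1%:Z%:~R :> R by [].
have -> : 2 = 2%:Z%:~R :> R by [].
by rewrite -intr_norm -intrM ler_int; lia.
Qed.

(** The factor 1 / r is the ratio of the average over 2 K + 1 frequencies to a
    Riemann sum of mesh 2 pi r / (2 K + 1), which stays bounded. *)
Lemma sum_nodes_le K (F : 'I_K.*2.+1 -> R[i]) (B r : R) : 0 < r -> r <= K.*2.+1%:R ->
  0 <= B ->
  (forall k, normc (F k) <= B * (1 + r * `|freq R K k|) ^- 2) ->
  normc (K.*2.+1%:R^-1 * \sum_(k < K.*2.+1) F k) <= 2 * B / r.
Proof.
move=> r0 rK B0 hF; set m := K.*2.+1 in rK hF *.
have m0 : 0 < m%:R :> R by rewrite ltr0n.
rewrite normcM -(rmorph_nat (real_complex R)) -fmorphV normc_real.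
rewrite gtr0_norm ?invr_gt0// mulrC ler_pdivrMr//.
apply: le_trans (normc_sum _ _ _) _.
apply: (@le_trans _ _ (B * (1 + 2 * (step K r)^-1))).
  apply: (@le_trans _ _ (\sum_(k < m) B * (1 + `|(k%:Z - K%:Z)%:~R| * step K r) ^- 2)).
    apply: ler_sum => k _; apply: le_trans (hF k) _.
    have -> : r * `|freq R K k| = `|(k%:Z - K%:Z)%:~R| * step K r.
      rewrite -{1}(gtr0_norm r0) -normrM freq_step normrM mulrC.
      by rewrite (gtr0_norm (step_gt0 _ r0)).
    exact: lexx.
  by rewrite -mulr_sumr ler_wpM2l// sum_decay_le// step_gt0.
have -> : 2 * B / r * m%:R = B * (m%:R / r + m%:R / r) by ring.
rewrite ler_wpM2l// lerD//; first by rewrite ler_pdivlMr// mul1r.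
have -> : 2 * (step K r)^-1 = m%:R / r / pi.
  rewrite /step -/m; have := pi_gt0 R; move: m0; move: (m%:R : R) (pi : R) => a b a0 b0.
  by field; rewrite !gt_eqF.
rewrite ler_pdivrMr ?pi_gt0// ler_peMr ?divr_ge0 ?(ltW m0) ?(ltW r0)//.
by have := pi_ge2 R; lra.
Qed.

Section Scale.
(** r is the v-th root of n, the spatial scale of the n-th power. *)
Variables (L v n : nat) (r : R).
Hypotheses (L0 : (0 < L)%N) (v2 : (2 <= v)%N).
Hypotheses (n0 : (0 < n)%N) (r0 : 0 < r) (rn : r ^+ v = n%:R).

Lemma scale_ge1 : 1 <= r.
Proof.
by rewrite -(@expr_ge1 _ v) ?rn ?ler1n ?(ltW r0)// (leq_trans _ v2).
Qed.

Lemma scale_le_nodes : r <= (n * L).*2.+1%:R.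
Proof.
apply: (@le_trans _ _ n%:R).
  by rewrite -rn ler_eXnr ?scale_ge1// (leq_trans _ v2).
by rewrite ler_nat; have := leq_pmulr n L0; lia.
Qed.

Lemma scale_le_support (x : int) : `|x|%:~R <= r -> `|x| <= (n * L)%:Z.
Proof.
move=> xr; have : `|x|%:~R <= n%:Z%:~R :> R.
  by apply: le_trans xr _; rewrite -pmulrn -rn ler_eXnr ?scale_ge1// (leq_trans _ v2).
by rewrite ler_int => /le_trans; apply; rewrite lez_nat leq_pmulr.
Qed.

Lemma scale_exp t : n%:R * t ^+ v = (r * t) ^+ v.
Proof. by rewrite exprMn rn. Qed.

End Scale.

Variables (phi : int -> R[i]) (L v : nat) (c C : R).
Hypothesis suppL : supported phi L.
Hypothesis L0 : (0 < L)%N.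
Hypothesis v2 : (2 <= v)%N.
Hypotheses (c0 : 0 < c) (C0 : 0 < C).
Hypothesis bound : forall t s, `|t| <= pi ->
  normc (symbol phi L (t +i* s)) <= expR (- (c * `|t| ^+ v) + C * `|s| ^+ v).

(** Inversion along the line of imaginary part s: the exponential cost is that of
    |P| ^ n at the point i s, and the decay in the real direction leaves the factor
    1 / r. *)
Lemma convpow_tilted : exists2 B, 0 < B &
  forall n r (x : int) s, (0 < n)%N -> 0 < r -> r ^+ v = n%:R ->
    normc (convpow phi n x) <=
    B / r * expR (x%:~R * s + C * (n%:R * `|s| ^+ v)).
Proof.
have v0 : (0 < v)%N by rewrite (leq_trans _ v2).
have [B B0 hB] := decay_exists 0 v0 c0; exists (2 * B); first by rewrite mulr_gt0.
move=> n r x s n0 r0 rn.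
have [->|/(convpow_supported suppL n0) xn] := eqVneq (convpow phi n x) 0.
  by rewrite normc0 !mulr_ge0 ?expR_ge0 ?invr_ge0 ?ltW.
pose E := expR (x%:~R * s + C * (n%:R * `|s| ^+ v)).
have E0 : 0 < E by exact: expR_gt0.
rewrite (convpow_inversion suppL (s *i) n0 xn) -/E.
have -> : 2 * B / r * E = 2 * (B * E) / r by ring.
apply: sum_nodes_le => //; first exact: scale_le_nodes L0 v2 n0 r0 rn.
  by rewrite mulr_ge0// ltW.
move=> k; set f := freq R (n * L) k.
have fE : f%:C + s *i = f +i* s.
  by apply: complexP; rewrite !(ReD, ImD)/= ?addr0 ?add0r.
rewrite fE normcM normcX normc_cexp.
have -> : Re (- (x%:~R * ('i * (f +i* s)))) = x%:~R * s.
  by rewrite -(rmorph_int (real_complex R)) !(ReN, ReM, ImM)/=; ring.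
have fpi : `|f| <= pi by apply: freq_le_pi; exact: ltn_ord.
apply: (@le_trans _ _ (expR (- (c * `|f| ^+ v) + C * `|s| ^+ v) ^+ n * expR (x%:~R * s))).
  rewrite ler_wpM2r ?expR_ge0// lerXn2r ?nnegrE ?normc_ge0 ?expR_ge0//.
  exact: bound.
rewrite -expRM_natl -expRD mulrAC.
have u0 : 0 <= r * `|f| by rewrite mulr_ge0 ?(ltW r0).
have := hB _ u0; rewrite expr0 mul1r -(scale_exp rn) => hf.
have -> : n%:R * (- (c * `|f| ^+ v) + C * `|s| ^+ v) + x%:~R * s =
   - (c * (n%:R * `|f| ^+ v)) + (x%:~R * s + C * (n%:R * `|s| ^+ v)) by ring.
by rewrite expRD ler_wpM2r ?(ltW E0).
Qed.

(** The tilt s proportional to q makes the linear gain beat the cost C s ^ v. *)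
Lemma convpow_upper_bound : exists c' C', [/\ 0 < c', 0 < C' &
  forall n r (x : int) q, (0 < n)%N -> 0 < r -> r ^+ v = n%:R -> 0 <= q ->
    `|x|%:~R = n%:R * q ^+ v.-1 ->
    normc (convpow phi n x) <= C' / r * expR (- (c' * (n%:R * q ^+ v)))].
Proof.
have [B B0 hB] := convpow_tilted.
(* kap makes C kap ^ v at most kap / 2, so that half of the gain kap survives. *)
pose kap := Num.min 1 (2 * C)^-1.
have k0 : 0 < kap by rewrite lt_min ltr01 invr_gt0 mulr_gt0.
have k1 : kap <= 1 by rewrite ge_min lexx.
have kC : C * kap <= 1 / 2.
  have : kap <= (2 * C)^-1 by rewrite ge_min lexx orbT.
  by rewrite -[(2 * C)^-1]mul1r ler_pdivlMr ?mulr_gt0//; lra.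
exists (kap / 2), B; split => //; first by lra.
move=> n r x q n0 r0 rn q0 xq.
apply: le_trans (hB n r x (- (Num.sg x)%:~R * (kap * q)) n0 r0 rn) _.
rewrite ler_wpM2l ?divr_ge0 ?(ltW r0) ?(ltW B0)// ler_expR.
have -> : x%:~R * (- (Num.sg x)%:~R * (kap * q)) = - (kap * (n%:R * q ^+ v)).
  have -> : x%:~R * (- (Num.sg x)%:~R * (kap * q)) = - (kap * (`|x|%:~R * q)).
    by rewrite normrEsg intrM; ring.
  rewrite xq; case: (v) v2 => // u _ /=; rewrite exprS; ring.
have nq : 0 <= n%:R * q ^+ v by rewrite mulr_ge0 ?exprn_ge0.
have hs : `|- (Num.sg x)%:~R * (kap * q)| ^+ v <= kap * (kap * q ^+ v).
  apply: (@le_trans _ _ ((kap * q) ^+ v)).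
    have kq0 : 0 <= kap * q by rewrite mulr_ge0// ltW.
    rewrite lerXn2r ?nnegrE// normrM normrN (ger0_norm kq0) ler_piMl//.
    by rewrite -intr_norm normr_sg; case: (x == 0).
  rewrite exprMn mulrA ler_wpM2r ?exprn_ge0//.
  case: (v) v2 => [|[|u]]// _; rewrite !exprS mulrA ler_piMr ?mulr_ge0 ?(ltW k0)//.
  by rewrite exprn_ile1// ltW.
have : C * (n%:R * `|- (Num.sg x)%:~R * (kap * q)| ^+ v) <=
    C * kap * (kap * (n%:R * q ^+ v)).
  have := ler_wpM2l (mulr_ge0 (ltW C0) (ler0n R n)) hs; lra.
have := ler_wpM2r (mulr_ge0 (ltW k0) nq) kC.
by lra.
Qed.

End UpperBound.

(** * Comparison with the stable kernel *)

Section KernelComparison.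
Variable R : realType.
Implicit Types (s u h r y : R) (z w : R[i]).

Lemma normc_exprB_le z w (rho : R) n : normc z <= rho -> normc w <= rho ->
  normc (z ^+ n - w ^+ n) <= normc (z - w) * (n%:R * rho ^+ n.-1).
Proof.
move=> hz hw; rewrite subrXX normcM ler_wpM2l ?normc_ge0//.
apply: le_trans (normc_sum _ _ _) _.
have rho0 : 0 <= rho := le_trans (normc_ge0 _) hz.
have -> : n%:R * rho ^+ n.-1 = \sum_(i < n) rho ^+ n.-1.
  by rewrite sumr_const card_ord mulr_natl.
apply: ler_sum => i _; rewrite normcM !normcX.
have -> : rho ^+ n.-1 = rho ^+ (n.-1 - i) * rho ^+ i.
  by rewrite -exprD; congr (_ ^+ _); have := ltn_ord i; clear; lia.
by apply: ler_pM; rewrite ?exprn_ge0 ?normc_ge0// lerXn2r ?nnegrE ?normc_ge0.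
Qed.

Lemma normc_cexpi_sub1 y : normc (cexp (y *i) - 1) <= 2 * `|y|.
Proof.
have d t : cderive (fun u => cexp (u%:C * (y *i))) t (y *i * cexp (t%:C * (y *i))).
  apply: cderive_cexp.
  by apply: cderive_eq (cderiveM (cderive_id t) (cderive_cst (y *i) t)) _; ring.
have := @cderive_le _ _ _ 0 1 `|y| ler01 d.
rewrite mul1r mul0r cexp0 subr0 mulr1; apply => t _.
rewrite normcM normc_i normc_cexp !(ReM, ImM) /= mulr0 mul0r subr0 expR0.
by rewrite mulr1.
Qed.

Variables (phi : int -> R[i]) (L v : nat) (gamma : R[i]) (c C : R).
Local Notation P := (symbol phi L).
Hypothesis suppL : supported phi L.
Hypothesis L0 : (0 < L)%N.
Hypothesis v2 : (2 <= v)%N.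
Hypothesis v_even : ~~ odd v.
Hypothesis gamma_gt0 : 0 < Re gamma.
Hypothesis expansion : forall B, exists2 C, 0 < C &
  forall z, normc z <= B -> normc (P z - 1 + gamma * z ^+ v) <= C * normc z ^+ v.+1.
Hypothesis c0 : 0 < c.
Hypothesis bound : forall t s, `|t| <= pi ->
  normc (symbol phi L (t +i* s)) <= expR (- (c * `|t| ^+ v) + C * `|s| ^+ v).

Let v_gt0 : (0 < v)%N. Proof. by rewrite (leq_trans _ v2). Qed.

(** The exponential replacing the symbol after rescaling; its inverse Fourier
    transform is the limiting kernel. *)
Definition stable u := cexp (- (gamma * (u ^+ v)%:C)).

Lemma stable_norm u : normc (stable u) = expR (- (Re gamma * `|u| ^+ v)).
Proof.
rewrite normc_cexp normr_even_exp// !(ReN, ReM)/=; congr (expR (- _)); ring.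
Qed.

Lemma symbol_sub_stable : exists2 D, 0 < D &
  forall t, `|t| <= pi -> normc (P t%:C - stable t) <= D * `|t| ^+ v.+1.
Proof.
have [C1 C10 h1] := expansion pi.
pose g := normc gamma; have g0 : 0 <= g := normc_ge0 _.
have p0 := pi_ge0 R.
pose C2 := 4 * (g ^+ 2 * pi ^+ v.-1) * expR (g * pi ^+ v).
have C20 : 0 <= C2 by rewrite !mulr_ge0 ?exprn_ge0 ?expR_ge0.
exists (C1 + C2); first by rewrite ltr_pwDl.
move=> t tpi; have tv0 := exprn_ge0 v (normr_ge0 t).
set w := - (gamma * (t ^+ v)%:C).
have wn : normc w = g * `|t| ^+ v by rewrite normcN normcM normc_real normrX.
have h2 := cexp_taylor 2 w.
rewrite !big_ord_recl big_ord0 !lift0 /= expr0 expr1 fact0 factS fact0 mul1n !divr1 addr0 in h2.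
have -> : P t%:C - stable t =
    (P t%:C - 1 + gamma * t%:C ^+ v) - (cexp w - (1 + w)).
  by rewrite /w rmorphXn /stable /= rmorphXn /=; ring.
apply: le_trans (normcB _ _) _; rewrite mulrDl; apply: lerD.
  by have := h1 t%:C; rewrite normc_real; apply.
apply: le_trans h2 _; rewrite wn.
have -> : C2 * `|t| ^+ v.+1 =
    2 ^+ 2 * (g ^+ 2 * (pi ^+ v.-1 * `|t| ^+ v.+1)) * expR (g * pi ^+ v).
  by rewrite /C2; ring.
have tvpi : `|t| ^+ v <= pi ^+ v by rewrite lerXn2r ?nnegrE.
apply: ler_pM; rewrite ?mulr_ge0 ?exprn_ge0 ?expR_ge0 ?mulr_ge0//; last first.
  by rewrite ler_expR ler_wpM2l.
rewrite ler_pM2l ?exprn_gt0// exprMn ler_wpM2l ?exprn_ge0//.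
have -> : (`|t| ^+ v) ^+ 2 = `|t| ^+ v.-1 * `|t| ^+ v.+1.
  by rewrite -exprM -exprD; congr (_ ^+ _); move: v_gt0; clear; lia.
by rewrite ler_wpM2r ?exprn_ge0// lerXn2r ?nnegrE.
Qed.

Definition kernel_sum n r (x : int) : R[i] :=
  (n * L).*2.+1%:R^-1 * \sum_(k < (n * L).*2.+1)
    stable (r * freq R (n * L) k) *
    cexp (- (x%:~R * ('i * (freq R (n * L) k)%:C))).

(** Of the n factors in the difference of n-th powers one is the error
    O(|t| ^ (v+1)), the others keep the Gaussian-type decay; rescaling by r leaves
    1 / r, and the average gives another 1 / r. *)
Lemma convpow_sub_kernel : exists2 D, 0 < D &
  forall n r (x : int), (1 < n)%N -> 0 < r -> r ^+ v = n%:R -> `|x| <= (n * L)%:Z ->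
    normc (convpow phi n x - kernel_sum n r x) <= D / r / r.
Proof.
have [D D0 hD] := symbol_sub_stable.
pose c' := Num.min c (Re gamma).
have c'0 : 0 < c' by rewrite lt_min c0.
have c'20 : 0 < c' / 2 by rewrite divr_gt0.
have [B B0 hB] := decay_exists v.+1 v_gt0 c'20.
exists (2 * (D * B)); first by rewrite !mulr_gt0.
move=> n r x n1 r0 rn xn; have n0 := ltnW n1.
rewrite (convpow_inversion suppL 0 n0 xn) /kernel_sum -mulrBr -sumrB.
have -> : 2 * (D * B) / r / r = 2 * (D * B / r) / r by ring.
apply: sum_nodes_le => //; first exact: scale_le_nodes L0 v2 n0 r0 rn.
  by rewrite !mulr_ge0 ?invr_ge0 ?ltW.
move=> k; set f := freq R (n * L) k.
have fpi : `|f| <= pi by apply: freq_le_pi; exact: ltn_ord.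
rewrite addr0 -mulrBl normcM.
have -> : normc (cexp (- (x%:~R * ('i * f%:C)))) = 1.
  rewrite normc_cexp -(rmorph_int (real_complex R)).
  have -> : Re (- (x%:~R%:C * ('i * f%:C))) = 0 by rewrite !(ReN, ReM, ImM)/=; ring.
  exact: expR0.
rewrite mulr1.
have -> : stable (r * f) = stable f ^+ n.
  rewrite /stable cexpX exprMn rn rmorphM /= rmorph_nat; congr cexp; ring.
pose rho := expR (- (c' * `|f| ^+ v)).
have fv0 : 0 <= `|f| ^+ v by rewrite exprn_ge0.
have hP : normc (P f%:C) <= rho.
  have := bound 0 fpi; rewrite normr0 expr0n gtn_eqF// mulr0 addr0.
  by move/le_trans; apply; rewrite ler_expR lerN2 ler_wpM2r// ge_min lexx.
have hS : normc (stable f) <= rho.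
  by rewrite stable_norm ler_expR lerN2 ler_wpM2r// ge_min lexx orbT.
apply: le_trans (normc_exprB_le n hP hS) _.
apply: le_trans (ler_wpM2r _ (hD _ fpi)) _.
  by rewrite mulr_ge0// exprn_ge0// expR_ge0.
have u0 : 0 <= r * `|f| by rewrite mulr_ge0// ltW.
have hrho : rho ^+ n.-1 <= expR (- (c' / 2 * (r * `|f|) ^+ v)).
  rewrite /rho -expRM_natl ler_expR -(scale_exp rn).
  have : n%:R <= 2 * n.-1%:R :> R by rewrite -natrM ler_nat; move: n1; clear; lia.
  move=> h; have := ler_wpM2r (mulr_ge0 (ltW c'0) fv0) h; lra.
have hn : n%:R * `|f| ^+ v.+1 = (r * `|f|) ^+ v.+1 / r.
  by rewrite exprMn [r ^+ _]exprS rn; field; rewrite gt_eqF.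
have -> : D * `|f| ^+ v.+1 * (n%:R * rho ^+ n.-1) =
    D / r * ((r * `|f|) ^+ v.+1 * rho ^+ n.-1).
  rewrite [RHS]mulrA -[D / r * _]mulrA [r^-1 * _]mulrC -hn; ring.
have -> : D * B / r * (1 + r * `|f|) ^- 2 = D / r * (B * (1 + r * `|f|) ^- 2) by ring.
rewrite ler_wpM2l ?divr_ge0 ?(ltW D0) ?(ltW r0)//.
apply: le_trans (hB _ u0); apply: ler_pM; rewrite ?exprn_ge0 ?expR_ge0//.
by rewrite lerXn2r ?nnegrE//; lra.
Qed.

(** The phase is Lipschitz in x with constant the frequency, which is u / r for
    a rescaled frequency u. *)
Lemma kernel_sum_recenter : exists2 D, 0 < D &
  forall n r (x : int), (0 < n)%N -> 0 < r -> r ^+ v = n%:R ->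
    normc (kernel_sum n r x - kernel_sum n r 0) <= D * (`|x|%:~R / r) / r.
Proof.
have [B B0 hB] := decay_exists 1 v_gt0 gamma_gt0.
exists (2 * (2 * B)); first by rewrite !mulr_gt0.
move=> n r x n0 r0 rn; rewrite /kernel_sum -mulrBr -sumrB.
set y := `|x|%:~R / r.
have y0 : 0 <= y by rewrite divr_ge0 ?(ltW r0)// ler0z.
rewrite -[2 * (2 * B) * y]mulrA.
apply: sum_nodes_le => //; first exact: scale_le_nodes L0 v2 n0 r0 rn.
  by apply: mulr_ge0 => //; rewrite mulr_ge0// ltW.
move=> k; set f := freq R (n * L) k.
rewrite -mulrBr normcM stable_norm normrM (gtr0_norm r0).
have -> : cexp (- (0%:~R * ('i * f%:C))) = 1 :> R[i] by rewrite mul0r oppr0 cexp0.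
have -> : - (x%:~R * ('i * f%:C)) = (- (x%:~R * f)) *i.
  rewrite -(rmorph_int (real_complex R)).
  by apply: complexP; rewrite !(ReN, ImN, ReM, ImM)/=; ring.
have u0 : 0 <= r * `|f| by rewrite mulr_ge0// ltW.
have hx : normc (cexp ((- (x%:~R * f)) *i) - 1) <= 2 * (y * (1 + r * `|f|)).
  apply: le_trans (normc_cexpi_sub1 _) _; rewrite ler_pM2l// normrN normrM.
  rewrite -intr_norm mulrDr mulr1 ler_wpDl//.
  by rewrite /y mulrA mulfVK// gt_eqF.
apply: le_trans (ler_wpM2l (expR_ge0 _) hx) _.
have := hB _ u0; rewrite expr1 => /(ler_wpM2l y0); lra.
Qed.

(** By the symmetry of the nodes the imaginary part is an odd sum. *)
Lemma kernel_sum_real n r (x : int) : Im gamma = 0 -> Im (kernel_sum n r x) = 0.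
Proof.
move=> g0; rewrite /kernel_sum; set K := (n * L)%N.
rewrite -(rmorph_nat (real_complex R)) -fmorphV ImM /= mul0r addr0.
suff -> : Im (\sum_(k < K.*2.+1) stable (r * freq R K k) *
    cexp (- (x%:~R * ('i * (freq R K k)%:C)))) = 0 by rewrite mulr0.
pose F (l : int) : R := - (expR (- (Re gamma * (step K r * l%:~R) ^+ v)) *
  sin (x%:~R * (step K 1 * l%:~R))).
rewrite Im_sum.
transitivity (\sum_(k < K.*2.+1) F (k%:Z - K%:Z)).
  apply: eq_bigr => k _; rewrite freq_step -[freq R K k]mul1r freq_step.
  rewrite /stable /F; set u := step K r * _; set f := step K 1 * _.
  rewrite !cexpE -(rmorph_int (real_complex R)) !(ImM, ReM, ImN, ReN) /= g0.
  rewrite ?(mul0r, mulr0, mul1r, mulr1, addr0, add0r, subr0, oppr0, sub0r, expR0, sin0, cos0).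
  by rewrite sinN; ring.
rewrite sum_symmetric.
have -> : F 0 = 0 by rewrite /F !mulr0 sin0 mulr0 oppr0.
rewrite add0r big1// => k _; rewrite /F mulrNz !mulrN sinN.
by rewrite -[(- (step K r * _)) ^+ v]normr_even_exp// normrN normr_even_exp//; ring.
Qed.

(** Evenness in the frequency folds the sum onto the half line; the node 0 is then
    counted twice. *)
Lemma kernel_sum0 n r :
  kernel_sum n r 0 = (n * L).*2.+1%:R^-1 *
    (2 * \sum_(k < (n * L).+1) stable (k%:R * step (n * L) r) - 1).
Proof.
rewrite /kernel_sum; set K := (n * L)%N; congr (_ * _).
pose F (l : int) := stable (step K r * l%:~R).
transitivity (\sum_(k < K.*2.+1) F (k%:Z - K%:Z)).
  by apply: eq_bigr => k _; rewrite mul0r oppr0 cexp0 mulr1 freq_step.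
rewrite sum_symmetric big_ord_recl mulrDr mulr_sumr.
have S0 : stable 0 = 1.
  by rewrite /stable expr0n gtn_eqF//= mulr0 oppr0 cexp0.
have -> : F 0 = 1 by rewrite /F mulr0 S0.
rewrite mul0r S0 mulr1.
have -> : forall y : R[i], 2 + y - 1 = 1 + y by move=> y; ring.
congr (_ + _).
apply: eq_bigr => k _; rewrite /F mulrNz mulrN -pmulrn lift0 mulrC.
have -> : stable (- (k.+1%:R * step K r)) = stable (k.+1%:R * step K r).
  by rewrite /stable -normr_even_exp// normrN normr_even_exp.
by ring.
Qed.

End KernelComparison.

(** * The kernel at the origin *)

Section Riemann.
Variable R : realType.
Implicit Types (u h t y : R).

Lemma is_derive_mulr y t : is_derive t (1 : R) (fun u => u * y) y.
Proof.
have h := is_deriveM (is_derive_id t 1) (is_derive_cst y t (1 : R)).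
by apply: is_derive_eq; rewrite /GRing.scale /= mulr0 add0r mulr1.
Qed.

(** Each cell contributes a Taylor error h ^ 2 times the second derivative at its left
    end; the integrable majorant makes these sum to the order of h. *)
Lemma riemann_derivative (g g' g'' : R -> R[i]) (B h : R) K :
  0 < h -> 0 <= B ->
  (forall u, cderive g u (g' u)) -> (forall u, cderive g' u (g'' u)) ->
  (forall u, 0 <= u -> normc (g'' u) <= B * (1 + u) ^- 2) ->
  normc (h%:C * \sum_(k < K) g' (k%:R * h) - (g (K%:R * h) - g 0)) <=
  4 * B * (h ^+ 2 + h).
Proof.
move=> h0 B0 dg dg' hg''.
have shift (f f' : R -> R[i]) y t : (forall u, cderive f u (f' u)) ->
    cderive (fun w => f (y + w)) t (f' (y + t)).
  move=> df; have [f1 f2] := df (y + t).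
  have ht : is_derive t (1 : R) (fun w => y + w) 1.
    by apply: is_derive_eq (is_deriveD (is_derive_cst y t 1) (is_derive_id t 1)) _; rewrite add0r.
  split.
    by apply: is_derive_eq (is_derive1_comp f1 ht) _; rewrite mulr1.
  by apply: is_derive_eq (is_derive1_comp f2 ht) _; rewrite mulr1.
have local y : 0 <= y ->
    normc (g (y + h) - g y - h%:C * g' y) <= 4 * B * h ^+ 2 * (1 + y) ^- 2.
  move=> y0; pose S := B * (1 + y) ^- 2.
  have S0 : 0 <= S by rewrite mulr_ge0// invr_ge0 exprn_ge0//; lra.
  have hS w : 0 <= w -> normc (g'' (y + w)) <= S.
    move=> w0; apply: le_trans (hg'' _ (addr_ge0 y0 w0)) _.
    rewrite ler_wpM2l// lef_pV2 ?posrE ?exprn_gt0//; [|lra|lra].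
    by rewrite lerXn2r ?nnegrE//; lra.
  have h1 w : 0 <= w -> w <= h -> normc (g' (y + w) - g' y) <= 2 * S * h.
    move=> w0 wh; have := cderive_le w0 (fun t => shift _ _ y t dg').
    move=> /(_ S); rewrite addr0 subr0 => H.
    apply: le_trans (H _) _; last by rewrite ler_wpM2l// mulr_ge0.
    by move=> t; rewrite in_itv /= => /andP[t0 _]; exact: hS.
  have d t : cderive (fun w => g (y + w) - w%:C * g' y) t (g' (y + t) - g' y).
    apply: cderiveB; first exact: shift.
    by apply: cderive_eq (cderiveM (cderive_id t) (cderive_cst _ _)) _; ring.
  have := cderive_le (ltW h0) d => /(_ (2 * S * h)).
  rewrite addr0 subr0 mul0r subr0 => H.
  have -> : g (y + h) - g y - h%:C * g' y = g (y + h) - h%:C * g' y - g y by ring.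
  apply: le_trans (H _) _.
    by move=> t; rewrite in_itv /= => /andP[t0 th]; exact: h1.
  by rewrite /S le_eqVlt; apply/orP; left; apply/eqP; ring.
have -> : h%:C * \sum_(k < K) g' (k%:R * h) - (g (K%:R * h) - g 0) =
    - \sum_(k < K) (g (k%:R * h + h) - g (k%:R * h) - h%:C * g' (k%:R * h)).
  elim: (K) => [|k ih]; first by rewrite !big_ord0 mul0r; ring.
  rewrite !big_ord_recr /= mulrDr [in RHS]opprD -ih.
  have -> : k.+1%:R * h = k%:R * h + h by rewrite -natr1; ring.
  ring.
rewrite normcN; apply: le_trans (normc_sum _ _ _) _.
apply: (@le_trans _ _ (4 * B * h ^+ 2 * \sum_(k < K) (1 + k%:R * h) ^- 2)).
  by rewrite mulr_sumr; apply: ler_sum => k _; apply: local; rewrite mulr_ge0// ltW.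
have hsum : \sum_(k < K) (1 + k%:R * h) ^- 2 <= 1 + h^-1.
  case: (K) => [|k]; first by rewrite big_ord0 addr_ge0// invr_ge0 ltW.
  rewrite big_ord_recl mul0r addr0 expr1n invr1 lerD2l.
  exact: sum_inv_sqr_le.
have -> : 4 * B * (h ^+ 2 + h) = 4 * B * h ^+ 2 * (1 + h^-1).
  by field; rewrite gt_eqF.
by apply: ler_wpM2l => //; apply: mulr_ge0; [exact: mulr_ge0 | exact: sqr_ge0].
Qed.

Variables (v : nat) (rho tau : R).
Hypothesis v2 : (2 <= v)%N.
Hypothesis v_even : ~~ odd v.
Hypothesis rho0 : 0 < rho.
Hypothesis tau_lt : `|tau| < pi / 2.

Let v_gt0 : (0 < v)%N. Proof. by rewrite (leq_trans _ v2). Qed.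
Let v_neq0 : v%:R != 0 :> R. Proof. by rewrite pnatr_eq0 -lt0n v_gt0. Qed.

Definition ray t : R[i] := rho%:C * cexp (t *i).

Lemma normc_ray t : normc (ray t) = rho.
Proof. by rewrite normcM normc_cexp expR0 mulr1 normc_real gtr0_norm. Qed.

Lemma Re_ray t : Re (ray t) = rho * cos t.
Proof. by rewrite ReM cexpE /= expR0; ring. Qed.

Let a := rho * cos tau.

Let a_gt0 : 0 < a.
Proof.
rewrite mulr_gt0// cos_gt0_pihalf//.
by move: tau_lt; rewrite ltr_norml.
Qed.

Lemma Re_ray_ge t : `|t| <= `|tau| -> a <= Re (ray t).
Proof.
move=> tt; rewrite Re_ray ler_wpM2l ?(ltW rho0)//.
have E (x : R) : cos x = cos `|x| by case: (ger0P x) => // _; rewrite cosN.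
rewrite (E tau) (E t) le_eqVlt; move: tt; rewrite le_eqVlt => /orP[/eqP->|tt].
  by rewrite eqxx.
have p0 := pi_gt0 R; have t0 := normr_ge0 t; have t1 := normr_ge0 tau.
have tp : `|tau| <= pi by have := tau_lt; lra.
apply/orP; right; rewrite ltr_cos ?in_itv//=; first by rewrite t0 (le_trans (ltW tt)).
by rewrite t1.
Qed.

(** Differentiating in the angle t the quantity
    exp (i t / v) * integral of exp (- ray t * u ^ v) du produces
    i / v * exp (i t / v) times the integral of the derivative in u of
    u * exp (- ray t * u ^ v), which is 0: this plays the part of the rotation of
    the contour of integration. The three functions are this primitive and its
    first two derivatives. *)
Definition bump t u : R[i] := u%:C * cexp (- (ray t * u%:C ^+ v)).
Definition bump1 t u : R[i] :=
  (1 - v%:R * (ray t * u%:C ^+ v)) * cexp (- (ray t * u%:C ^+ v)).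
Definition bump2 t u : R[i] :=
  - (v%:R * (ray t * u%:C ^+ v.-1)) * (v%:R + 1 - v%:R * (ray t * u%:C ^+ v)) *
  cexp (- (ray t * u%:C ^+ v)).

Lemma real_expS u : u%:C ^+ v = u%:C * u%:C ^+ v.-1.
Proof. by rewrite -exprS prednK. Qed.

Lemma cderive_pow t u :
  cderive (fun u => ray t * u%:C ^+ v) u (v%:R * (ray t * u%:C ^+ v.-1)).
Proof.
by apply: cderive_eq (cderiveZ _ (cderiveX v (cderive_id u))) _; ring.
Qed.

Lemma cderive_bump t u : cderive (bump t) u (bump1 t u).
Proof.
have h := cderive_cexp (cderiveN (cderive_pow t u)).
apply: cderive_eq (cderiveM (cderive_id u) h) _.
by rewrite /bump1 real_expS; ring.
Qed.

Lemma cderive_bump1 t u : cderive (bump1 t) u (bump2 t u).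
Proof.
have h := cderive_cexp (cderiveN (cderive_pow t u)).
have h1 := cderiveB (cderive_cst 1 u) (cderiveZ v%:R (cderive_pow t u)).
apply: cderive_eq (cderiveM h1 h) _.
by rewrite /bump2; ring.
Qed.

Lemma normc_cexp_ray t u : `|t| <= `|tau| ->
  normc (cexp (- (ray t * u%:C ^+ v))) <= expR (- (a * `|u| ^+ v)).
Proof.
move=> tt; rewrite normc_cexp ler_expR.
have -> : u%:C ^+ v = (`|u| ^+ v)%:C by rewrite normr_even_exp// rmorphXn.
rewrite ReN [Re (_ * _)]ReM [Im _%:C]/= mulr0 subr0 lerN2.
by rewrite ler_wpM2r ?exprn_ge0//; exact: Re_ray_ge.
Qed.

Lemma bump_bounds : exists2 B, 0 < B & forall t u, `|t| <= `|tau| -> 0 <= u ->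
  normc (bump t u) <= B * (1 + u) ^- 2 /\ normc (bump2 t u) <= B * (1 + u) ^- 2.
Proof.
have [B1 B10 h1] := decay_exists 1 v_gt0 a_gt0.
have [B2 B20 h2] := decay_exists (v.-1 + v) v_gt0 a_gt0.
pose A := v%:R * rho * (v%:R + 1 + v%:R * rho).
have A0 : 0 <= A by rewrite !mulr_ge0 ?addr_ge0 ?mulr_ge0 ?ler0n ?(ltW rho0).
exists (B1 + A * B2); first by rewrite ltr_pwDl// mulr_ge0// ltW.
move=> t u tt u0; have u1 : 0 <= (1 + u) ^- 2 by rewrite invr_ge0 exprn_ge0//; lra.
have he := normc_cexp_ray u tt; rewrite (ger0_norm u0) in he.
have e0 := expR_ge0 (- (a * u ^+ v)).
rewrite mulrDl; split.
  apply: (@le_trans _ _ (B1 * (1 + u) ^- 2)); last first.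
    by rewrite lerDl (mulr_ge0 (mulr_ge0 A0 (ltW B20)) u1).
  apply: le_trans (h1 u u0); rewrite normcM normc_real (ger0_norm u0) expr1.
  by apply: ler_pM; rewrite ?normc_ge0//; lra.
apply: (@le_trans _ _ (A * B2 * (1 + u) ^- 2)); last first.
  by rewrite lerDr (mulr_ge0 (ltW B10) u1).
have {}h2 := ler_wpM2l A0 (h2 u u0).
rewrite -[A * B2 * _]mulrA; apply: le_trans h2; rewrite mulrA.
rewrite normcM; apply: ler_pM; rewrite ?normc_ge0//.
have nR (k : nat) : normc (k%:R : R[i]) = k%:R.
  by rewrite -(rmorph_nat (real_complex R)) normc_real normr_nat.
rewrite normcM normcN normcM normcM normc_ray normcX normc_real (ger0_norm u0) nR.
rewrite exprD.
have lX k : u ^+ k <= (1 + u) ^+ k by rewrite lerXn2r ?nnegrE//; lra.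
have -> : A * ((1 + u) ^+ v.-1 * (1 + u) ^+ v) =
  v%:R * (rho * (1 + u) ^+ v.-1) * ((v%:R + 1 + v%:R * rho) * (1 + u) ^+ v).
  by rewrite /A; ring.
apply: ler_pM; rewrite ?mulr_ge0 ?normc_ge0 ?exprn_ge0 ?ler0n ?(ltW rho0)//.
  by rewrite ler_wpM2l// ler_wpM2l ?(ltW rho0)//; exact: lX.
apply: le_trans (normcB _ _) _; rewrite normcM normcM normc_ray normcX normc_real nR (ger0_norm u0).
have : normc (v%:R + 1 : R[i]) <= v%:R + 1.
  by apply: le_trans (normcD _ _) _; rewrite nR normc1.
have : 1 <= (1 + u) ^+ v by rewrite exprn_ege1//; lra.
have := lX v; have v0 : 0 <= v%:R :> R by rewrite ler0n.
move: (u ^+ v) ((1 + u) ^+ v) (normc _) => x y z xy y1 zv.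
have := ler_wpM2l (mulr_ge0 v0 (ltW rho0)) xy.
have : 0 <= (v%:R + 1) * (y - 1) by rewrite mulr_ge0 ?subr_ge0 ?addr_ge0.
by lra.
Qed.

(** The sum over the nodes, multiplied by the phase that makes its limit
    independent of t. *)
Definition rotated h K t : R[i] := cexp ((t / v%:R) *i) *
  (h%:C * \sum_(k < K) cexp (- (ray t * (k%:R * h)%:C ^+ v))).

Lemma cderive_rotated h K t : cderive (rotated h K) t
  (v%:R^-1%:C * 'i * cexp ((t / v%:R) *i) *
   (h%:C * \sum_(k < K) bump1 t (k%:R * h))).
Proof.
have dray : cderive ray t ('i * ray t).
  have d : cderive (fun u => u *i) t 'i.
    by split; [exact: is_derive_cst | exact: is_derive_id].
  by apply: cderive_eq (cderiveZ _ (cderive_cexp d)) _; rewrite mulrCA.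
have dphase : cderive (fun t => cexp ((t / v%:R) *i)) t
    (v%:R^-1 *i * cexp ((t / v%:R) *i)).
  by apply: cderive_cexp; split; [exact: is_derive_cst | exact: is_derive_mulr].
have dsum := cderive_sum (fun k : 'I_K => cderive_cexp (cderiveN
  (cderiveM dray (cderive_cst ((k%:R * h)%:C ^+ v) t)))).
apply: cderive_eq (cderiveM dphase (cderiveZ h%:C dsum)) _.
have iE : v%:R^-1 *i = v%:R^-1%:C * 'i :> R[i].
  by apply: complexP; rewrite !(ReM, ImM)/=; ring.
have vi : v%:R * v%:R^-1%:C = 1 :> R[i].
  by rewrite -(rmorph_nat (real_complex R)) -rmorphM mulfV.
rewrite iE; set e := cexp _; set s1 := \sum_(k < K) cexp _; set s2 := \sum_(k < K) _ * _.
transitivity (v%:R^-1%:C * 'i * e * (h%:C * (s1 + v%:R * (- 'i) * s2))).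
  have i2 : 'i * 'i = -1 :> R[i] by rewrite -expr2 sqr_i.
  have -> : v%:R^-1%:C * 'i * e * (h%:C * (s1 + v%:R * - 'i * s2)) =
    v%:R^-1%:C * 'i * e * (h%:C * s1) -
    (v%:R * v%:R^-1%:C) * ('i * 'i) * (e * (h%:C * s2)) by ring.
  by rewrite vi i2; ring.
congr (_ * (_ * _)); rewrite /s1 /s2 mulr_sumr -big_split; apply: eq_bigr => k _ /=.
have i2 : 'i * 'i = -1 :> R[i] by rewrite -expr2 sqr_i.
rewrite /bump1; set x := ray t * _.
have -> : v%:R * - 'i * (- ('i * ray t * (k%:R * h)%:C ^+ v + ray t * 0) * cexp (- x)) =
  v%:R * ('i * 'i) * x * cexp (- x) by rewrite /x; ring.
by rewrite i2; ring.
Qed.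

Lemma rotated_stationary : exists2 D, 0 < D & forall h K, 0 < h ->
  normc (rotated h K tau - rotated h K 0) <= D * (h ^+ 2 + h + (K%:R * h + 1)^-1).
Proof.
have [B B0 hB] := bump_bounds.
have B5 : 0 <= 4 * B + B by lra.
exists (2 * (`|tau| * (4 * B + B)) + 1); first by rewrite ltr_wpDl// !mulr_ge0.
move=> h K h0; have U0 : 0 <= K%:R * h by rewrite mulr_ge0// ltW.
set E := h ^+ 2 + h + _.
have I0 : 0 < (K%:R * h + 1)^-1 by rewrite invr_gt0; lra.
have E0 : 0 <= E by rewrite !addr_ge0 ?exprn_ge0 ?(ltW h0) ?(ltW I0).
have d t : cderive (fun w => rotated h K (w * tau)) t
    (tau%:C * (v%:R^-1%:C * 'i * cexp ((t * tau / v%:R) *i) *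
   (h%:C * \sum_(k < K) bump1 (t * tau) (k%:R * h)))).
  have [r1 r2] := cderive_rotated h K (t * tau).
  have ht := is_derive_mulr tau t.
  have h1 := is_derive1_comp (g := fun w => w * tau) r1 ht.
  have h2 := is_derive1_comp (g := fun w => w * tau) r2 ht.
  rewrite mulrC; split; first by rewrite ReM mulr0 subr0.
  by rewrite ImM mulr0 add0r.
have := cderive_le ler01 d => /(_ (`|tau| * ((4 * B + B) * E))).
rewrite mul1r mul0r subr0 mulr1 => H; apply: le_trans (H _) _; last first.
  by rewrite [leRHS]mulrDl mul1r -!mulrA lerDl.
move=> t; rewrite in_itv /= => /andP[t0 t1].
have tt : `|t * tau| <= `|tau| by rewrite normrM (ger0_norm t0) ler_piMl.
have e1 : normc (cexp ((t * tau / v%:R) *i)) = 1 by rewrite normc_cexp expR0.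
rewrite normcM normc_real ler_wpM2l// normcM [normc (_ * cexp _)]normcM e1 mulr1.
rewrite [normc (_ * 'i)]normcM normc_real normc_i normr1 mulr1.
have i1 : `|v%:R^-1| <= 1 :> R.
  by rewrite ger0_norm ?invr_ge0// invf_le1 ?ler1n// ltr0n.
apply: le_trans (ler_wpM2r (normc_ge0 _) i1) _; rewrite mul1r.
have h2 u : 0 <= u -> normc (bump2 (t * tau) u) <= B * (1 + u) ^- 2.
  by move=> u0; have [] := hB _ _ tt u0.
have hr := riemann_derivative K h0 (ltW B0) (cderive_bump _) (cderive_bump1 _) h2.
have hb := (hB _ _ tt U0).1.
have b0 : bump (t * tau) 0 = 0 by rewrite /bump mul0r.
rewrite b0 subr0 in hr.
set S := _ * \sum_(k < K) _ in hr *.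
rewrite -(subrK (bump (t * tau) (K%:R * h)) S).
apply: le_trans (normcD _ _) _; apply: le_trans (lerD hr hb) _.
have hi : (1 + K%:R * h) ^- 2 <= (K%:R * h + 1)^-1.
  rewrite lef_pV2 ?posrE ?exprn_gt0//; [|lra|lra].
  by rewrite [1 + _]addrC ler_eXnr//; lra.
have := ler_wpM2l (ltW B0) hi; have := mulr_ge0 (ltW B0) (ltW h0).
have := mulr_ge0 (ltW B0) (sqr_ge0 h); have := mulr_ge0 (ltW B0) (ltW I0).
by rewrite /E; lra.
Qed.

(** For t = 0 all terms are positive, and those with node at most 1 contribute
    at least exp (- rho) times a total length of min 1 (K h). *)
Lemma rotated0_ge h K : 0 < h -> exists2 G : R, rotated h K 0 = G%:C &
  Num.min 1 (K%:R * h) * expR (- rho) <= G.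
Proof.
move=> h0.
have rayE : ray 0 = rho%:C by rewrite /ray cexpE /= expR0 cos0 sin0 !mul1r mulr1.
exists (h * \sum_(k < K) expR (- (rho * (k%:R * h) ^+ v))).
  rewrite /rotated mul0r cexp0 mul1r rmorphM rmorph_sum; congr (_ * _).
  by apply: eq_bigr => k _ /=; rewrite -cexp_real rayE rmorphN [in RHS]rmorphM [in RHS]rmorphXn.
elim: K => [|K ih]; first by rewrite big_ord0 mul0r mulr0 minEle ler10 mul0r.
rewrite big_ord_recr /= mulrDr.
have e0 := expR_ge0 (- (rho * (K%:R * h) ^+ v)).
have p0 := expR_gt0 (- rho).
have U0 : 0 <= K%:R * h by rewrite mulr_ge0// ltW.
have [U1|U1] := leP 1 (K%:R * h).
  apply: le_trans (le_trans _ ih) _; last by rewrite lerDl mulr_ge0// ltW.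
  by rewrite ler_pM2r// (min_idPl U1) ge_min lexx.
have h1 : h * expR (- rho) <= h * expR (- (rho * (K%:R * h) ^+ v)).
  rewrite ler_pM2l// ler_expR lerN2 ler_piMr ?(ltW rho0)//.
  by rewrite exprn_ile1// ltW.
apply: le_trans (lerD ih h1).
rewrite -mulrDl ler_pM2r// (min_idPr (ltW U1)) ge_min; apply/orP; right.
by rewrite -natr1 mulrDl mul1r.
Qed.

End Riemann.

(** * The local limit *)

Section LocalLimit.
Variable R : realType.
Implicit Types (r q : R).

Lemma polar (gamma : R[i]) : 0 < Re gamma ->
  exists2 tau, `|tau| < pi / 2 & gamma = ray (normc gamma) tau.
Proof.
case: gamma => a b /= a0; exists (atan (b / a)).
  by rewrite ltr_norml atan_gtNpi2 atan_ltpi2.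
have c0 : 0 < cos (atan (b / a)).
  by apply: cos_gt0_pihalf; rewrite atan_gtNpi2 atan_ltpi2.
have rE : Num.sqrt (a ^+ 2 + b ^+ 2) * cos (atan (b / a)) = a.
  rewrite cos_atan; have -> : a ^+ 2 + b ^+ 2 = a ^+ 2 * (1 + (b / a) ^+ 2).
    by field; rewrite gt_eqF.
  rewrite sqrtrM ?sqr_ge0// sqrtr_sqr gtr0_norm// mulfK//.
  by rewrite gt_eqF// sqrtr_gt0 ltr_pwDl// sqr_ge0.
have sE : sin (atan (b / a)) = b / a * cos (atan (b / a)).
  have cn0 : cos (atan (b / a)) != 0 by rewrite gt_eqF.
  by rewrite -[LHS](mulfVK cn0) -/(tan _) atanK.
apply: complexP; rewrite /ray cexpE !(ReM, ImM) /= expR0 !mul1r mul0r ?subr0 ?addr0.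
  by rewrite rE.
by rewrite sE mulrCA rE mulfVK// gt_eqF.
Qed.

Lemma powR_scale (v n : nat) r q (X : R) : (2 <= v)%N -> 0 < r -> r ^+ v = n%:R ->
  0 <= q -> X = n%:R * q ^+ v.-1 ->
  (X / r) `^ (v%:R / (v%:R - 1)) = n%:R * q ^+ v.
Proof.
move=> v2 r0 rn q0 ->.
have -> : n%:R * q ^+ v.-1 / r = (r * q) ^+ v.-1.
  rewrite -rn exprMn; case: (v) v2 => // u _ /=.
  by rewrite exprS; field; rewrite gt_eqF.
have rq0 : 0 <= r * q by rewrite mulr_ge0// ltW.
have -> : v%:R - 1 = v.-1%:R :> R by case: (v) v2 => // u _; rewrite -natr1 addrK.
rewrite -powR_mulrn// -powRrM [_ * (_ / _)]mulrC mulfVK.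
  by rewrite powR_mulrn// exprMn rn.
by rewrite pnatr_eq0; case: (v) v2 => [|[]].
Qed.

Lemma root_unbounded (v : nat) (A : R) : (2 <= v)%N -> exists2 N, (1 < N)%N &
  forall n r, (N <= n)%N -> 0 < r -> r ^+ v = n%:R -> A <= r.
Proof.
move=> v2; pose A' := Num.max 0 A.
have A0 : 0 <= A' by rewrite le_max lexx.
exists (Num.truncn (A' ^+ v)).+2 => // n r Nn r0 rn.
apply: (@le_trans _ _ A'); first by rewrite le_max lexx orbT.
rewrite -(@ler_pXn2r _ v) ?nnegrE ?(ltW r0)//; last by rewrite (leq_trans _ v2).
rewrite rn; have /andP[_ h] := truncn_itv (exprn_ge0 v A0).
apply: le_trans (ltW h) _; rewrite ler_nat; exact: ltnW.
Qed.

Variables (phi : int -> R[i]) (L v : nat) (gamma : R[i]) (c C tau : R).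
Hypothesis suppL : supported phi L.
Hypothesis L0 : (0 < L)%N.
Hypothesis v2 : (2 <= v)%N.
Hypothesis v_even : ~~ odd v.
Hypothesis gamma_gt0 : 0 < Re gamma.
Hypothesis expansion : forall B, exists2 C, 0 < C & forall z, normc z <= B ->
  normc (symbol phi L z - 1 + gamma * z ^+ v) <= C * normc z ^+ v.+1.
Hypothesis c0 : 0 < c.
Hypothesis bound : forall t s, `|t| <= pi ->
  normc (symbol phi L (t +i* s)) <= expR (- (c * `|t| ^+ v) + C * `|s| ^+ v).
Hypothesis tau_lt : `|tau| < pi / 2.
Hypothesis gammaE : gamma = ray (normc gamma) tau.

Let rho0 : 0 < normc gamma. Proof. exact: gamma_norm_gt0. Qed.

Lemma step_bounds n r : (0 < n)%N -> 0 < r -> r ^+ v = n%:R ->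
  step (n * L) r <= 8 / r /\ r <= (n * L).+1%:R * step (n * L) r.
Proof.
move=> n0 r0 rn; have r1 := scale_ge1 v2 n0 r0 rn.
have pi4 : pi < 4 :> R by have := pihalf_lt2 R; lra.
have pi2 := pi_ge2 R.
set K := (n * L)%N; have nK : (n <= K)%N by rewrite leq_pmulr.
have m0 : 0 < K.*2.+1%:R :> R by rewrite ltr0n.
have mE : K.*2.+1%:R = 2 * K%:R + 1 :> R by rewrite -muln2 -natr1 natrM mulrC.
have K0 : 0 <= K%:R :> R by [].
rewrite /step; split.
  have rr : r * r <= K.*2.+1%:R.
    apply: (@le_trans _ _ n%:R).
      by rewrite -rn -expr2 ler_weXn2l.
    by rewrite ler_nat; move: nK; clear; lia.
  rewrite ler_pdivrMr// [8 / r * _]mulrAC ler_pdivlMr// -mulrA.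
  have rr0 : 0 <= r * r by rewrite mulr_ge0// ltW.
  by have := ler_wpM2r rr0 (ltW pi4); lra.
rewrite mulrA ler_pdivlMr// mE -natr1.
have : 0 <= r * (2 * (pi * (K%:R + 1)) - (2 * K%:R + 1)).
  rewrite mulr_ge0 ?(ltW r0)//.
  have : 0 <= (pi - 2) * (K%:R + 1) :> R by rewrite mulr_ge0//; lra.
  by lra.
by lra.
Qed.

(** After multiplication by r the kernel at 0 is, up to O(1 / r), a positive number
    bounded below turned by the angle - tau / v, because the integral of
    exp (- gamma u ^ v) is a positive multiple of the power - 1 / v of gamma. *)
Lemma local_limit : exists2 D, 0 < D &
  forall n r (x : int), (1 < n)%N -> 0 < r -> r ^+ v = n%:R -> `|x| <= (n * L)%:Z ->
  exists2 G : R, expR (- normc gamma) <= G &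
    normc (r%:C * convpow phi n x - (G / pi)%:C * cexp ((- (tau / v%:R)) *i)) <=
    D * (1 + `|x|%:~R) / r.
Proof.
have [D1 D10 h1] := convpow_sub_kernel suppL L0 v2 v_even gamma_gt0 expansion c0 bound.
have [D2 D20 h2] := kernel_sum_recenter L0 v2 v_even gamma_gt0.
have [D3 D30 h3] := rotated_stationary v2 v_even rho0 tau_lt.
exists (D1 + D2 + 73 * D3 + 8); first by lra.
move=> n r x n1 r0 rn xn; have n0 := ltnW n1.
have r1 := scale_ge1 v2 n0 r0 rn.
have [hh hU] := step_bounds n0 r0 rn.
have p2 := pi_ge2 R.
set K := (n * L)%N in xn hh hU *; set h := step K r in hh hU *.
have h0 : 0 < h := step_gt0 K r0.
have [G GE Gge] := rotated0_ge v rho0 K.+1 h0.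
exists G.
  by rewrite (min_idPl (le_trans r1 hU)) mul1r in Gge.
pose J := rotated v (normc gamma) h K.+1 tau.
pose e := cexp ((- (tau / v%:R)) *i).
have e1 : normc e = 1 by rewrite normc_cexp expR0.
have kE : r%:C * kernel_sum L v gamma n r 0 = pi^-1%:C * (e * J) - (h / (2 * pi))%:C.
  rewrite kernel_sum0// -/K -/h /J /rotated [e * (_ * _)]mulrA -cexpD.
  have -> : (- (tau / v%:R)) *i + (tau / v%:R) *i = 0 :> R[i].
    by apply: complexP; rewrite ?(ReD, ImD) /=; ring.
  rewrite cexp0 mul1r.
  have -> : \sum_(k < K.+1) stable v gamma (k%:R * h) =
      \sum_(k < K.+1) cexp (- (ray (normc gamma) tau * (k%:R * h)%:C ^+ v)).
    by apply: eq_bigr => k _; rewrite /stable -gammaE rmorphXn.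
  move: (\sum_(k < _) _) => S.
  have -> : (K.*2.+1%:R : R[i])^-1 = (K.*2.+1%:R^-1)%:C.
    by rewrite fmorphV rmorph_nat.
  have m0 : 0 < K.*2.+1%:R :> R by rewrite ltr0n.
  have rm : r * K.*2.+1%:R^-1 = h / (2 * pi).
    by rewrite /h /step; field; rewrite !gt_eqF//; lra.
  have hp : h / (2 * pi) * 2 = pi^-1 * h by field; rewrite gt_eqF//; lra.
  have -> : r%:C * (K.*2.+1%:R^-1%:C * (2 * S - 1)) =
    (r * K.*2.+1%:R^-1 * 2)%:C * S - (r * K.*2.+1%:R^-1)%:C.
    by rewrite !rmorphM /= (rmorph_nat (real_complex R) 2); ring.
  by rewrite rm hp rmorphM /=; ring.
have hJ := h3 h K.+1 h0; rewrite GE -/J in hJ.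
have -> : r%:C * convpow phi n x - (G / pi)%:C * e =
    r%:C * (convpow phi n x - kernel_sum L v gamma n r x) +
    r%:C * (kernel_sum L v gamma n r x - kernel_sum L v gamma n r 0) +
    (pi^-1%:C * (e * (J - G%:C)) - (h / (2 * pi))%:C).
  rewrite [(_ * (_ - kernel_sum _ _ _ _ _ 0))]mulrBr kE.
  by rewrite rmorphM /=; ring.
apply: le_trans (normcD _ _) _.
have b1 : normc (r%:C * (convpow phi n x - kernel_sum L v gamma n r x)) <= D1 / r.
  rewrite normcM normc_real gtr0_norm// mulrC -ler_pdivlMr//; exact: h1.
have b2 : normc (r%:C * (kernel_sum L v gamma n r x - kernel_sum L v gamma n r 0)) <=
    D2 * `|x|%:~R / r.
  rewrite normcM normc_real gtr0_norm// mulrC -ler_pdivlMr//.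
  by apply: le_trans (h2 n r x n0 r0 rn) _; rewrite mulrA.
have ri0 : 0 < r^-1 by rewrite invr_gt0.
have ri1 : r^-1 <= 1 by rewrite invf_le1.
have b3 : normc (pi^-1%:C * (e * (J - G%:C))) <= 73 * D3 / r.
  rewrite normcM normc_real normcM e1 mul1r ger0_norm ?invr_ge0 ?pi_ge0//.
  apply: (@le_trans _ _ (D3 * (h ^+ 2 + h + (K.+1%:R * h + 1)^-1))).
    by apply: le_trans (ler_piMl (normc_ge0 _) _) hJ; rewrite invf_le1//; lra.
  have i1 : (K.+1%:R * h + 1)^-1 <= r^-1 by rewrite lef_pV2 ?posrE//; lra.
  have i2 : h ^+ 2 <= 64 / r.
    apply: (@le_trans _ _ ((8 / r) ^+ 2)).
      by rewrite lerXn2r ?nnegrE ?(ltW h0)// (le_trans (ltW h0) hh).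
    have -> : (8 / r) ^+ 2 = 64 * (r^-1 * r^-1) by ring.
    by rewrite ler_pM2l// ler_piMr// ltW.
  have : h ^+ 2 + h + (K.+1%:R * h + 1)^-1 <= 73 / r by lra.
  by move/(ler_wpM2l (ltW D30)); lra.
have b4 : normc (h / (2 * pi))%:C <= 8 / r.
  have p20 : 0 < 2 * pi :> R by lra.
  rewrite normc_real ger0_norm; last by rewrite mulr_ge0 ?(ltW h0)// invr_ge0 ltW.
  apply: le_trans hh; rewrite ler_pdivrMr// ler_peMr ?(ltW h0)//; lra.
have x0 : 0 <= `|x|%:~R / r by rewrite divr_ge0 ?ler0z ?(ltW r0).
apply: le_trans (lerD (normcD _ _) (normcB _ _)) _.
have : 0 <= (D1 + 73 * D3 + 8) * (`|x|%:~R / r) by rewrite mulr_ge0//; lra.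
have : 0 <= D2 / r by rewrite divr_ge0 ?(ltW D20) ?(ltW r0).
by lra.
Qed.

End LocalLimit.

(** * Lower bounds *)

Section LowerBounds.
Variable R : realType.
Variables (phi : int -> R[i]) (L v : nat) (gamma : R[i]) (c C tau : R).
Hypothesis suppL : supported phi L.
Hypothesis L0 : (0 < L)%N.
Hypothesis v2 : (2 <= v)%N.
Hypothesis v_even : ~~ odd v.
Hypothesis gamma_gt0 : 0 < Re gamma.
Hypothesis expansion : forall B, exists2 C, 0 < C & forall z, normc z <= B ->
  normc (symbol phi L z - 1 + gamma * z ^+ v) <= C * normc z ^+ v.+1.
Hypothesis c0 : 0 < c.
Hypothesis bound : forall t s, `|t| <= pi ->
  normc (symbol phi L (t +i* s)) <= expR (- (c * `|t| ^+ v) + C * `|s| ^+ v).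
Hypothesis tau_lt : `|tau| < pi / 2.
Hypothesis gammaE : gamma = ray (normc gamma) tau.

Let angle_lt : `|tau / v%:R| < pi / 2.
Proof.
apply: le_lt_trans tau_lt; rewrite normrM ler_piMr// normfV normr_nat.
by rewrite invf_le1 ?ler1n ?ltr0n (leq_trans _ v2).
Qed.

Lemma sin_gt0_half (x : R) : 0 < x -> `|x| < pi / 2 -> 0 < sin x.
Proof. by move=> x0; rewrite gtr0_norm// => xp; apply: sin_gt0_pihalf; rewrite x0. Qed.

Lemma sgr_sin_half (x : R) : `|x| < pi / 2 -> Num.sg (sin x) = Num.sg x.
Proof.
move=> xp; case: (ltgtP x 0) => [x0|x0|->]; last by rewrite sin0.
  rewrite (ltr0_sg x0) ltr0_sg// -oppr_gt0 -sinN sin_gt0_half ?oppr_gt0//.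
  by rewrite normrN.
by rewrite (gtr0_sg x0) gtr0_sg// sin_gt0_half.
Qed.

(** Both tau and tau / v lie within a quarter turn of 0, where the sine has the
    sign of its argument. *)
Lemma sgr_Im_gamma : Num.sg (Im gamma) = Num.sg (sin (tau / v%:R)).
Proof.
rewrite sgr_sin_half// sgrM [Num.sg _^-1]gtr0_sg ?invr_gt0 ?ltr0n ?(leq_trans _ v2)//.
rewrite mulr1 -(sgr_sin_half tau_lt) gammaE ImM cexpE /= expR0 mul1r mul0r addr0.
by rewrite sgrM gtr0_sg ?mul1r// gamma_norm_gt0.
Qed.

Lemma convpow_lower_bound : exists c1 c2 N, [/\ 0 < c1, c1 <= 1, 0 < c2, (1 < N)%N &
  forall n r (x : int), (N <= n)%N -> 0 < r -> r ^+ v = n%:R -> `|x|%:~R <= c1 * r ->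
    c2 / r <= Re (convpow phi n x) /\
    (Im gamma != 0 -> c2 / r <= - Num.sg (Im gamma) * Im (convpow phi n x))].
Proof.
have [D D0 hD] := local_limit suppL L0 v2 v_even gamma_gt0 expansion c0 bound tau_lt gammaE.
have p0 := pi_gt0 R.
pose m := expR (- normc gamma) / pi.
have m0 : 0 < m by rewrite divr_gt0// expR_gt0.
have := angle_lt; set th := tau / v%:R => th_lt.
have cos0 : 0 < cos th by apply: cos_gt0_pihalf; rewrite -ltr_norml.
(* The sine bounds the imaginary part; it vanishes exactly for real gamma, whence
   the harmless value 1 there. *)
pose kap := m * Num.min (cos th) (if Im gamma == 0 then 1 else `|sin th|).
have kap0 : 0 < kap.
  rewrite mulr_gt0// lt_min cos0 /=; case: ifPn => //.
  by rewrite -sgr_eq0 sgr_Im_gamma sgr_eq0 normr_gt0.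
have [N N1 hN] := root_unbounded (4 * D / kap) v2.
(* The error D (1 + |x|) / r is at most kap / 4 for its constant part by the choice
   of N, and kap / 4 for its part linear in |x| by the choice of c1. *)
exists (Num.min 1 (kap / (4 * D))), (kap / 2), N; split => //.
- by rewrite lt_min ltr01 divr_gt0// mulr_gt0.
- by rewrite ge_min lexx.
- by rewrite divr_gt0.
move=> n r x Nn r0 rn xr.
have n1 : (1 < n)%N := leq_trans N1 Nn.
have [xr1 xrk] : `|x|%:~R <= r /\ `|x|%:~R <= kap / (4 * D) * r.
  split; apply: le_trans xr _.
    by rewrite ler_piMl ?(ltW r0)// ge_min lexx.
  by rewrite ler_wpM2r ?(ltW r0)// ge_min lexx orbT.
have xn := scale_le_support L0 v2 (ltnW n1) r0 rn xr1.
have [G Gge hG] := hD n r x n1 r0 rn xn.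
have err : D * (1 + `|x|%:~R) / r <= kap / 2.
  have h1 : D / r <= kap / 4.
    rewrite ler_pdivrMr//; have := hN n r Nn r0 rn.
    by rewrite ler_pdivrMr//; lra.
  have h2 : D * `|x|%:~R / r <= kap / 4.
    rewrite ler_pdivrMr//; have := ler_wpM2l (ltW D0) xrk.
    have -> : D * (kap / (4 * D) * r) = kap / 4 * r by field; rewrite gt_eqF.
    by [].
  by rewrite mulrDr mulr1 mulrDl; lra.
have {err} hG := le_trans hG err.
have Gm : m <= G / pi by rewrite ler_wpM2r// invr_ge0 ltW.
rewrite !ler_pdivrMr//; split.
  have := le_trans (Re_le_normc _) hG.
  rewrite ReD ReN !ReM cexpE /= expR0 !mul0r !subr0 mul1r cosN -/th.
  rewrite ler_norml => /andP[h _].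
  have : kap <= m * cos th by rewrite ler_pM2l// ge_min lexx.
  by have := ler_wpM2r (ltW cos0) Gm; lra.
move=> Ig; have := le_trans (Im_le_normc _) hG.
rewrite ImD ImN !ImM cexpE /= expR0 !mul0r !addr0 mul1r sinN -/th.
have sE : sin th = Num.sg (Im gamma) * `|sin th|.
  by rewrite sgr_Im_gamma -/th -numEsg.
have ks : kap <= m * `|sin th|.
  by rewrite ler_pM2l// ge_min (negbTE Ig) lexx orbT.
have gs := ler_wpM2r (normr_ge0 (sin th)) Gm.
rewrite sE ler_norml => /andP[h1 h2].
move: Ig h1 h2; rewrite -sgr_eq0.
by case: sgrP => _ Ig h1 h2; [rewrite eqxx in Ig | lra | lra].
Qed.

Lemma convpow_Im_negligible e : Im gamma = 0 -> 0 < e -> exists2 N, (1 < N)%N &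
  forall n r (x : int), (N <= n)%N -> 0 < r -> r ^+ v = n%:R -> `|x|%:~R <= r ->
    `|Im (convpow phi n x)| <= e / r.
Proof.
move=> Ig e0.
have [D D0 hD] := convpow_sub_kernel suppL L0 v2 v_even gamma_gt0 expansion c0 bound.
have [N N1 hN] := root_unbounded (D / e) v2; exists N => // n r x Nn r0 rn xr.
have n1 : (1 < n)%N := leq_trans N1 Nn.
have xn := scale_le_support L0 v2 (ltnW n1) r0 rn xr.
have := le_trans (Im_le_normc _) (hD n r x n1 r0 rn xn).
rewrite ImD ImN kernel_sum_real// subr0 => /le_trans; apply.
rewrite ler_wpM2r ?invr_ge0 ?(ltW r0)// ler_pdivrMr//.
by have := hN n r Nn r0 rn; rewrite ler_pdivrMr// mulrC.
Qed.

End LowerBounds.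

Theorem theorem1p1 (R : realType) (phi : int -> R[i]) (nu : int)
    (gamma : R[i]) :
  finite_set [set x : int | phi x != 0] ->
  \sum_(x \in [set: int]) phi x = 1 ->
  (forall t : R, t \in `]- pi, pi] -> t != 0 -> `|fourier phi t| < 1) ->
  (2 %| nu)%Z ->
  0 < complex.Re gamma ->
  (exists2 eps : R -> R[i],
     (eps t : R[i]^o) @[t --> (0 : R)^'] --> (0 : R[i]^o)
     & \forall t \near (0 : R)^',
         fourier phi t = cexp (- gamma * (t ^ nu)%:C * (1 + eps t))) ->
  (exists c C : R, [/\ 0 < c, 0 < C &
     forall (x : int) (n : nat), (0 < n)%N ->
       `|convpow phi n x| <=
         (C / (n%:R `^ (nu%:~R)^-1) *
          expR (- (c * ((`|x|%:~R / n%:R `^ (nu%:~R)^-1)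
                          `^ (nu%:~R / (nu%:~R - 1))))))%:C])
  /\
  (exists (c1 c2 : R) (N : nat), [/\ 0 < c1, 0 < c2,
     (forall (x : int) (n : nat), (N <= n)%N ->
        `|x|%:~R <= c1 * n%:R `^ (nu%:~R)^-1 ->
        c2 * n%:R `^ (- (nu%:~R)^-1) <= complex.Re (convpow phi n x)),
     (complex.Im gamma != 0 ->
        forall (x : int) (n : nat), (N <= n)%N ->
        `|x|%:~R <= c1 * n%:R `^ (nu%:~R)^-1 ->
        c2 * n%:R `^ (- (nu%:~R)^-1) <= `|complex.Im (convpow phi n x)| /\
        Num.sg (complex.Im (convpow phi n x)) = - Num.sg (complex.Im gamma))
   & (complex.Im gamma = 0 ->
        forall e : R, 0 < e -> \forall n \near \oo, forall x : int,
        `|x|%:~R <= c1 * n%:R `^ (nu%:~R)^-1 ->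
        `|complex.Im (convpow phi n x)| <= e * n%:R `^ (- (nu%:~R)^-1))]).
Proof.
move=> fin sum1 lt1 even_nu gamma0 [eps eps0 asym].
have [L L0 suppL] := finite_supported fin.
have P0 : symbol phi L 0 = 1 by rewrite -sum_symbol.
have Pnu : \forall t \near (0 : R)^',
    symbol phi L t%:C = cexp (- gamma * (t ^ nu)%:C * (1 + eps t)).
  by apply: filterS asym => t; rewrite (fourier_symbol suppL).
have [v [nuE v2 v_even]] := exponent_ge2 P0 gamma0 even_nu eps0 Pnu.
have expansion B := symbol_expansion gamma0 eps0 Pnu nuE v2 B.
have P_lt1 t : 0 < `|t| <= pi -> normc (symbol phi L t%:C) < 1.
  rewrite normr_gt0 => /andP[t0 tpi]; rewrite -(fourier_symbol suppL).
  have key s : s \in `]- pi, pi] -> s != 0 -> normc (fourier phi s) < 1.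
    by move=> s1 s2; have := lt1 s s1 s2; rewrite normc_norm ltcR.
  move: tpi; rewrite ler_norml le_eqVlt => /andP[/orP[/eqP tE|tl] tu]; last first.
    by apply: key; rewrite // in_itv /= tl.
  (* t = - pi is outside the half-open period, but equivalent to pi. *)
  rewrite -tE (fourier_symbol suppL) symbol_endpoints -(fourier_symbol suppL).
  by apply: key; rewrite ?gt_eqF ?in_itv /= ?lexx ?andbT ?pi_gt0//; have := pi_gt0 R; lra.
have [c [C [c0 C0 bound]]] := symbol_bound gamma0 v2 v_even expansion P_lt1.
have [tau tau_lt gammaE] := polar gamma0.
pose r n : R := n%:R `^ (nu%:~R)^-1.
have vE : nu%:~R = v%:R :> R by rewrite nuE.
have v_neq0 : v%:R != 0 :> R by rewrite pnatr_eq0 -lt0n (leq_trans _ v2).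
have r0 n : (0 < n)%N -> 0 < r n by move=> n0; rewrite powR_gt0// ltr0n.
have rn n : (0 < n)%N -> r n ^+ v = n%:R.
  move=> n0; rewrite -powR_mulrn ?powR_ge0// -powRrM vE mulVf// powRr1//.
have rV n : n%:R `^ (- (nu%:~R)^-1) = (r n)^-1 by rewrite powRN.
split.
  have [c' [C' [c'0 C'0 H]]] := convpow_upper_bound suppL L0 v2 c0 C0 bound.
  exists c', C'; split => // x n n0; rewrite normc_norm lecR -/(r n) vE.
  (* q is the order of the optimal tilt for the deviation x. *)
  pose q := (`|x|%:~R / n%:R) `^ (v.-1%:R)^-1 : R.
  have q0 : 0 <= q by exact: powR_ge0.
  have xq : `|x|%:~R = n%:R * q ^+ v.-1.
    rewrite /q -powR_mulrn ?powR_ge0// -powRrM mulVf ?powRr1.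
    - by rewrite mulrC mulfVK// pnatr_eq0 -lt0n.
    - by rewrite divr_ge0// ler0z.
    by rewrite pnatr_eq0; case: (v) v2 => [|[]].
  by rewrite (powR_scale v2 (r0 _ n0) (rn _ n0) q0 xq); apply: H => //; [exact: r0|exact: rn].
have [c1 [c2 [N [c10 c11 c20 N1 H]]]] :=
  convpow_lower_bound suppL L0 v2 v_even gamma0 expansion c0 bound tau_lt gammaE.
have pos n : (N <= n)%N -> (0 < n)%N by apply: leq_trans; exact: ltnW.
exists c1, c2, N; split => //.
- move=> x n Nn xr; rewrite rV.
  by have [] := H n (r n) x Nn (r0 _ (pos _ Nn)) (rn _ (pos _ Nn)) xr.
- move=> Ig x n Nn xr; rewrite rV.
  have [_ /(_ Ig)] := H n (r n) x Nn (r0 _ (pos _ Nn)) (rn _ (pos _ Nn)) xr.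
  have : 0 < c2 / r n by rewrite divr_gt0// r0// pos.
  move: (Im (convpow phi n x)) (c2 / r n) Ig => y d; rewrite -sgr_eq0.
  case: sgrP => y0 Ig d0; first by rewrite eqxx in Ig.
    by rewrite mulN1r => h; rewrite ltr0_norm ?ltr0_sg//; lra.
  by rewrite opprK mul1r => h; rewrite gtr0_norm ?gtr0_sg//; lra.
move=> Ig e e0.
have [M M1 HM] := convpow_Im_negligible suppL L0 v2 v_even gamma0 expansion c0 bound Ig e0.
exists M => // n /= Mn x xr; have n0 : (0 < n)%N by apply: leq_trans Mn; exact: ltnW.
rewrite rV; apply: HM => //; [exact: r0|exact: rn|].
by apply: le_trans xr _; rewrite -/(r n) ler_piMl// ltW// r0.
Qed.
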